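(* Suppose there are constants $c,c',c''>0$ such that $c|F|^p-c'\le W_{\rm cell}(F)\le c''(|F|^p+1)$ for every $F\in V_0$. Suppose in addition that: (i) $W_{\rm cell}(RF+(b,\dots,b))=W_{\rm cell}(F)$ for all $F\in\mathbb R^{d\times2^d}$, $R\in SO(d)$, $b\in\mathbb R^d$; (ii) $W_{\rm cell}(F)$ is minimal ($=0$) if and only if there exist $R\in SO(d)$ and $b\in\mathbb R^d$ such that $F=RZ+(b,\dots,b)$; (iii) $W_{\rm cell}$ is $C^2$ in a neighborhood of $SO(d)Z$ and the Hessian $D^2W_{\rm cell}(Z)$ is positive definite on the orthogonal complement of the subspace spanned by translations $(b,\dots,b)$, $b\in\mathbb R^d$, and infinitesimal rotations $BZ$ with $B\in\mathbb R^{d\times d}$, $B^T=-B$; (iv) $p\ge d$. Then there is a neighborhood $\mathcal U$ of $SO(d)$ in $\mathbb R^{d\times d}$ such that for all $M\in\mathcal U$ $$W_{\rm cont}(M)=W_{\rm CB}(M):=\frac1{|\det A|}W_{\rm cell}(MZ).$$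
   Context: Let $d\in\mathbb N$, $1<p<\infty$. Let $A\in\mathbb R^{d\times d}$ be invertible and $\mathcal L=A\mathbb Z^d$. The cells $z+A[0,1)^d$, $z\in\mathcal L$, partition $\mathbb R^d$; $Q_1(x)$ is the cell containing $x$, $\bar x$ is the center of that cell, and $\mathcal L_1'=\mathcal L+A(\frac12,\dots,\frac12)^T$ is the set of all centers. Let $z_1,\dots,z_{2^d}$ be the points of $A\{-\frac12,\frac12\}^d$ and $Z=(z_1,\dots,z_{2^d})\in\mathbb R^{d\times2^d}$. For open $U\subset\mathbb R^d$: $\mathcal L_1'(U)=\{x\in\mathcal L'_1:\overline{Q_1(x)}\cap U\ne\emptyset\}$, $(\mathcal L_1'(U))^\circ=\{x\in\mathcal L'_1:\overline{Q_1(x)}\subset U\}$, $\partial\mathcal L_1'(U)=\mathcal L_1'(U)\setminus(\mathcal L_1'(U))^\circ$, $\partial\mathcal L_1(U)=\partial\mathcal L_1'(U)+\{z_1,\dots,z_{2^d}\}$. $\mathcal B_1(U)$ is the set of functions with values in $\mathbb R^d$ that on $U$ are constant on every cell $Q_1(x)$ (intersected with $U$), $x\in\mathcal L'_1(U)$. For continuous $g\colon\mathbb R^d\to\mathbb R^d$, $\mathcal B_1(U,g)$ is the set of $y\in\mathcal B_1(U)$ with $y(x)=g(\bar x)$ for $x\in\partial\mathcal L_1(U)$, i.e. the constant value of $y$ on the cell $Q_1(x)$ is $g(\bar x)$ for each $x\in\partial\mathcal L_1(U)$ whose cell meets $U$. For $y\in\mathcal B_1(U)$ and $x\in(\mathcal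 L'_1(U))^\circ$ put $y_i=y(x+z_i)$, $\bar y=2^{-d}\sum_{i=1}^{2^d}y_i$ and $\bar\nabla y(x)=(y_1-\bar y,\dots,y_{2^d}-\bar y)\in\mathbb R^{d\times 2^d}$. Put $V_0=\{F=(a_{ij})\in\mathbb R^{d\times2^d}:\sum_{j=1}^{2^d}a_{ij}=0\ \text{for } i=1,\dots,d\}$. $W_{\rm cell}\colon\mathbb R^{d\times2^d}\to[0,\infty)$ is the cell energy, and with $y_M(x)=Mx$, for $M\in\mathbb R^{d\times d}$, $$W_{\rm cont}(M)=\frac1{|\det A|}\lim_{N\to\infty}\frac1{N^d}\inf\Big\{\sum_{x\in(\mathcal L_1'(A(0,N)^d))^\circ}W_{\rm cell}(\bar\nabla y(x))\colon y\in\mathcal B_1(A(0,N)^d,y_M)\Big\}$$ (the limit exists under the growth hypotheses).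
   Formalization: W_cell is additionally assumed lower semicontinuous; without some such regularity the claim fails, e.g. d=1, A=1, p=2, W_cell(F)=w(F_2-F_1) with w(t)=(t-1)^2 except w(3+1/k)=1/k, where W_cont(M)=0<W_CB(M) for M slightly above 1. *)

(* Defs.v *)
From HB Require Import structures.
From mathcomp Require Import all_boot all_order all_algebra.
From mathcomp Require Import all_classical all_reals all_analysis.

Set Implicit Arguments.
Unset Strict Implicit.
Unset Printing Implicit Defensive.

Import Order.TTheory GRing.Theory Num.Theory.
Import numFieldNormedType.Exports.

Local Open Scope classical_set_scope.
Local Open Scope ring_scope.

Section Lattice.
Context {R : realType} {d : nat}.
Implicit Types (A : 'M[R]_d) (x u z : 'cV[R]_d) (U : set 'cV[R]_d).

Definition lattice A : set 'cV[R]_d :=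
  [set A *m map_mx intr k | k in [set: 'cV[int]_d]].

Definition cell A z : set 'cV[R]_d :=
  [set z + A *m t | t in [set t : 'cV[R]_d | forall i, 0 <= t i 0 < 1]].

(* For invertible A, the unique lattice point z with x \in cell A z; see
   cell_cornerP. *)
Definition cell_corner A x : 'cV[R]_d :=
  A *m \col_i (Num.floor ((invmx A *m x) i 0))%:~R.

Lemma cell_cornerP A x z : A \in unitmx ->
  (lattice A z /\ cell A z x) <-> z = cell_corner A x.
Proof.
move=> uA; split=> [[[k _ <-] [t t01 <-]]|->].
  congr (A *m _); apply/colP => i.
  rewrite -mulmxDr mulKmx// !mxE; congr (_%:~R).
  by apply/esym/floor_def; rewrite intrD lerDl ltrD2l; exact: t01.
split; first by exists (\col_i Num.floor ((invmx A *m x) i 0)) => //;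
  congr (A *m _); apply/colP => i; rewrite !mxE.
exists (invmx A *m x - \col_i (Num.floor ((invmx A *m x) i 0))%:~R).
  move=> i; rewrite mxE [X in _ + X]mxE [X in _ - X]mxE.
  rewrite subr_ge0 floor_le ltrBlDl.
  by have := floorD1_gt ((invmx A *m x) i 0); rewrite intrD.
by rewrite /cell_corner -mulmxDr addrC subrK mulKVmx.
Qed.

Definition Q1 A x : set 'cV[R]_d := cell A (cell_corner A x).

Definition center A x : 'cV[R]_d := cell_corner A x + A *m const_mx 2^-1.

Definition centers A : set 'cV[R]_d :=
  [set z + A *m const_mx 2^-1 | z in lattice A].

Definition centers_in A U : set 'cV[R]_d :=
  [set x | centers A x /\ closure (Q1 A x) `&` U !=set0].

Definition int_centers A U : set 'cV[R]_d :=
  [set x | centers A x /\ closure (Q1 A x) `<=` U].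

Definition bd_centers A U : set 'cV[R]_d := centers_in A U `\` int_centers A U.

(* The columns of Z list the 2^d points of A{-1/2,1/2}^d, in any order. *)
Definition corner_enum A (Z : 'M[R]_(d, (2 ^ d)%N)) : Prop :=
  injective (fun j => col j Z) /\
  range (fun j => col j Z) =
  [set A *m t | t in
    [set t : 'cV[R]_d | forall i, t i 0 = - 2^-1 \/ t i 0 = 2^-1]].

Definition bd_lattice A (Z : 'M[R]_(d, (2 ^ d)%N)) U : set 'cV[R]_d :=
  [set x + col j Z | x in bd_centers A U & j in [set: 'I_(2 ^ d)%N]].

(* Deformations are total functions on R^d; only their values on U matter. *)
Definition B1 A U : set ('cV[R]_d -> 'cV[R]_d) :=
  [set y | forall x, centers_in A U x ->
    forall u v, (Q1 A x `&` U) u -> (Q1 A x `&` U) v -> y u = y v].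

Definition B1_bd A (Z : 'M[R]_(d, (2 ^ d)%N)) U (g : 'cV[R]_d -> 'cV[R]_d) :
    set ('cV[R]_d -> 'cV[R]_d) :=
  [set y | B1 A U y /\
    forall x, bd_lattice A Z U x ->
      forall u, (Q1 A x `&` U) u -> y u = g (center A x)].

Definition dgrad (Z : 'M[R]_(d, (2 ^ d)%N)) (y : 'cV[R]_d -> 'cV[R]_d) x :
    'M[R]_(d, (2 ^ d)%N) :=
  let ybar := (2 ^ d)%:R^-1 *: \sum_(j < 2 ^ d) y (x + col j Z) in
  \matrix_(i, j) (y (x + col j Z) - ybar) i 0.

Definition cube A (N : nat) : set 'cV[R]_d :=
  [set A *m t | t in [set t : 'cV[R]_d | forall i, 0 < t i 0 < N%:R]].

End Lattice.

Section Energy.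
Context {R : realType} {d : nat}.
Implicit Types (A M : 'M[R]_d) (Z : 'M[R]_(d, (2 ^ d)%N)).
Implicit Types (W : 'M[R]_(d, (2 ^ d)%N) -> R).

Definition min_energy A Z W M (N : nat) : R :=
  inf [set \sum_(x \in int_centers A (cube A N)) W (dgrad Z y x)
      | y in B1_bd A Z (cube A N) (mulmx M)].

Definition scaled_min_energy A Z W M : R ^nat :=
  fun N => (N%:R ^+ d)^-1 * min_energy A Z W M N.

Definition W_cont A Z W M : R :=
  `|\det A|^-1 * lim (scaled_min_energy A Z W M @ \oo).

Definition W_CB A Z W M : R := `|\det A|^-1 * W (M *m Z).

End Energy.

Section Matrices.
Context {R : realType}.

Definition SO (d : nat) : set 'M[R]_d :=
  [set Q | Q^T *m Q = 1%:M /\ \det Q = 1].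

Definition mxdot (m n : nat) (F G : 'M[R]_(m, n)) : R :=
  \sum_i \sum_j F i j * G i j.

(* The library's norm `|F| on matrices is the maximum norm. *)
Definition frob (m n : nat) (F : 'M[R]_(m, n)) : R := Num.sqrt (mxdot F F).

Definition V0 (m n : nat) : set 'M[R]_(m, n) :=
  [set F | forall i, \sum_j F i j = 0].

Definition transl (m n : nat) (b : 'cV[R]_m) : 'M[R]_(m, n) :=
  \matrix_(i, j) b i 0.

Definition infinitesimal_rigid (m n : nat) (Z : 'M[R]_(m, n)) :
    set 'M[R]_(m, n) :=
  [set transl n b + B *m Z | b in [set: 'cV[R]_m]
                           & B in [set B : 'M[R]_m | B^T = - B]].

Definition orthogonal_compl (m n : nat) (S : set 'M[R]_(m, n)) :
    set 'M[R]_(m, n) :=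
  [set F | forall G, S G -> mxdot F G = 0].

Definition hessian (V : normedModType R) (W : V -> R) (X F G : V) : R :=
  'D_G ('D_F W) X.

(* For this to hold on an open set means that W is C^2 there. *)
Definition C2_at (V : normedModType R) (W : V -> R) (X : V) : Prop :=
  [/\ differentiable W X,
      forall F, differentiable ('D_F W) X &
      forall F G, {for X, continuous (fun Y => hessian W Y F G)}].

End Matrices.

(* Main.v *)
Require Import Defs.
From HB Require Import structures.
From mathcomp Require Import all_boot all_order all_algebra.
From mathcomp Require Import all_classical all_reals all_analysis.
From mathcomp Require Import ring lra zify.
Set Implicit Arguments.
Unset Strict Implicit.
Unset Printing Implicit Defensive.
Import Order.TTheory GRing.Theory Num.Theory.
Import numFieldNormedType.Exports.
Local Open Scope classical_set_scope.
Local Open Scope ring_scope.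

(** Let [Q(G)] be a quadratic form of the discrete gradient whose sum over all
    cells depends on the boundary values only. If, for an affine map [M] and
    some linear [L],
      [W (M Z) + L G <= W (M Z + G) + e Q(G)]   for all [G],
    then Jensen's inequality applies: summed over the cells of a competitor with
    the boundary values of [M], the linear terms and the null Lagrangian [Q]
    drop out, and the affine map is a minimizer for every size of the cube
    ([min_energy_affine]). The inequality says that [W + e Q(. - M Z)] has a
    supporting hyperplane at [M Z].

    Convexity of [W] itself fails because of the rotations, and [Q] has to
    repair this. The form [null_form] is the discretization, by signed areas of
    quadrilaterals, of [e2 H = (tr H)^2 - tr (H^2)]: on the affine map [H] it
    equals [e2 H] ([null_form_mulmx]), and its sum over a field with zero
    boundary values vanishes ([sum_null_form]), since such a field lives on a
    discrete torus, where correlations are translation invariant. What makes it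
    useful is that [e2 (Q - 1) > 0] for every rotation [Q <> 1]
    ([e2_rotation_gt0]), with a quadratic lower bound near the identity
    ([e2_rotation_ge]). Being quadratic rather than of degree [d], it is
    controlled at infinity by [W] as soon as [p >= 2]; in dimension one it is
    zero and [p > 1] is enough.

    Consequently [W + e Q(. - Z)] has, for small [e], a nondegenerate strict
    minimum at [Z] with at least linear growth ([global_coercive]). Close to [Z]
    one splits [G = R Z + E] with the nearest rotation [R] ([optimal_rotation]):
    [W] controls [E] through the Hessian hypothesis and frame indifference, and
    [Q] controls [R - 1] ([near_coercive]). Away from [Z] a compactness argument
    applies ([compact_penalty]), and at infinity the growth of [W]
    ([far_coercive]). Such a minimum has a positive definite Hessian, so nearby
    points have supporting hyperplanes ([supporting_form]); frame indifference
    transports the result from the identity to all rotations. *)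

(** * Norms and scalar products of matrices *)

Section MatrixNorm.
Context {R : realType}.

Lemma Lipschitz_continuous (V W : normedModType R) (f : V -> W) (c : R) :
  (forall u v, `|f u - f v| <= c * `|u - v|) -> continuous f.
Proof.
move=> fc v; have c1 : 0 < `|c| + 1 by rewrite ltr_wpDl.
apply/cvgrPdist_lt => e e0; near=> u.
apply: le_lt_trans (fc _ _) _; apply: (@le_lt_trans _ _ ((`|c| + 1) * `|v - u|)).
  by rewrite ler_wpM2r// (le_trans (ler_norm _))// lerDl.
rewrite mulrC -ltr_pdivlMr//; near: u; apply: cvgr_dist_lt; first exact: cvg_id.
by rewrite divr_gt0.
Unshelve. all: by end_near. Qed.

Lemma mx_norm_entry (m n : nat) (F : 'M[R]_(m, n)) i j : `|F i j| <= `|F|.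
Proof.
rewrite [leRHS]/Num.Def.normr/= mx_normrE.
exact: (le_bigmax _ (fun ij : 'I_m * 'I_n => `|F ij.1 ij.2|) (i, j)).
Qed.

Lemma mx_norm_le (m n : nat) (F : 'M[R]_(m, n)) (c : R) :
  0 <= c -> (forall i j, `|F i j| <= c) -> `|F| <= c.
Proof.
move=> c0 Fc; rewrite [leLHS]/Num.Def.normr/= mx_normrE.
by apply: bigmax_le => // -[i j] _; exact: Fc.
Qed.

Lemma sumr_le_const (n : nat) (f : 'I_n -> R) (c : R) :
  (forall i, f i <= c) -> \sum_i f i <= n%:R * c.
Proof.
move=> fc; rewrite (le_trans (ler_sum _ (fun i _ => fc i)))//.
by rewrite sumr_const card_ord mulr_natl.
Qed.

Lemma mulmx_norm (m n p : nat) (F : 'M[R]_(m, n)) (G : 'M[R]_(n, p)) :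
  `|F *m G| <= n%:R * `|F| * `|G|.
Proof.
apply: mx_norm_le => [|i j]; first by rewrite !mulr_ge0.
rewrite mxE (le_trans (ler_norm_sum _ _ _))//.
rewrite -mulrA sumr_le_const// => k.
by rewrite normrM ler_pM// mx_norm_entry.
Qed.

Lemma mxdotE (m n : nat) (F G : 'M[R]_(m, n)) : mxdot F G = \tr (F *m G^T).
Proof.
by apply: eq_bigr => i _; rewrite mxE; apply: eq_bigr => j _; rewrite mxE.
Qed.

Lemma mxdotC (m n : nat) (F G : 'M[R]_(m, n)) : mxdot F G = mxdot G F.
Proof. by do 2!apply: eq_bigr => ? _; rewrite mulrC. Qed.

Lemma mxdotDr (m n : nat) (F G H : 'M[R]_(m, n)) :
  mxdot F (G + H) = mxdot F G + mxdot F H.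
Proof. by rewrite !mxdotE linearD/= mulmxDr mxtraceD. Qed.

Lemma mxdotZr (m n : nat) a (F G : 'M[R]_(m, n)) :
  mxdot F (a *: G) = a * mxdot F G.
Proof. by rewrite !mxdotE linearZ/= -scalemxAr mxtraceZ. Qed.

Lemma mxdotBr (m n : nat) (F G H : 'M[R]_(m, n)) :
  mxdot F (G - H) = mxdot F G - mxdot F H.
Proof. by rewrite -scaleN1r mxdotDr mxdotZr mulN1r. Qed.

Lemma mxdotDl (m n : nat) (F G H : 'M[R]_(m, n)) :
  mxdot (G + H) F = mxdot G F + mxdot H F.
Proof. by rewrite mxdotC mxdotDr !(mxdotC F). Qed.

Lemma mxdotBl (m n : nat) (F G H : 'M[R]_(m, n)) :
  mxdot (G - H) F = mxdot G F - mxdot H F.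
Proof. by rewrite mxdotC mxdotBr !(mxdotC F). Qed.

Lemma sqr_norm_le_mxdot (m n : nat) (F : 'M[R]_(m, n)) : `|F| ^+ 2 <= mxdot F F.
Proof.
have F0 : 0 <= mxdot F F by do 2!apply: sumr_ge0 => ? _; rewrite -expr2 sqr_ge0.
rewrite -[leRHS]sqr_sqrtr// ler_sqr ?nnegrE ?sqrtr_ge0//.
apply: mx_norm_le => [|i j]; rewrite ?sqrtr_ge0//.
rewrite -sqrtr_sqr ler_wsqrtr// /mxdot (bigD1 i)//= (bigD1 j)//= -expr2 -addrA.
by rewrite lerDl addr_ge0//; do ?apply: sumr_ge0 => ? _; rewrite -expr2 sqr_ge0.
Qed.

Lemma mxdot_le_sqr_norm (m n : nat) (F : 'M[R]_(m, n)) :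
  mxdot F F <= (m * n)%:R * `|F| ^+ 2.
Proof.
rewrite natrM -mulrA sumr_le_const// => i; rewrite sumr_le_const// => j.
by rewrite -expr2 -real_normK ?num_real// lerXn2r ?nnegrE// mx_norm_entry.
Qed.

Lemma closed_bounded_compact_mx (m n : nat) (K : set 'M[R]_(m, n)) (c : R) :
  closed K -> (forall F, K F -> `|F| <= c) -> compact K.
Proof.
move=> clK Kc.
have cvec : continuous (vec_mx : 'rV[R]_(m * n) -> 'M[R]_(m, n)).
  apply: (@Lipschitz_continuous _ _ _ 1) => u v; rewrite mul1r.
  apply: mx_norm_le => // i j; rewrite -linearB/= mxE.
  exact: mx_norm_entry.
have -> : K = vec_mx @` (vec_mx @^-1` K).
  rewrite eqEsubset; split => [F KF|_ [v Kv <-]//].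
  by exists (mxvec F); rewrite /= mxvecK.
apply: continuous_compact; first exact: continuous_subspaceT.
apply: bounded_closed_compact; last exact: preimage_closed.
exists c; split; rewrite ?num_real// => x cx v /= /Kc vc.
apply: le_trans (ltW cx); apply: le_trans vc; apply: mx_norm_le => // i j.
rewrite (ord1 i) -[v in leLHS]vec_mxK; case/mxvec_indexP: j => k l.
by rewrite mxvecE mx_norm_entry.
Qed.

End MatrixNorm.

Lemma continuous_sumr (R : realType) (T : topologicalType) (I : finType)
    (f : I -> T -> R) :
  (forall i, continuous (f i)) -> continuous (fun x => \sum_i f i x).
Proof.
move=> cf x; rewrite (_ : (fun x => _) = \sum_i f i); last first.
  by apply/funext => y; rewrite fct_sumE.
elim/big_ind : _ => [|g h cg ch|i _]; first exact: cst_continuous.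
  exact: (continuousD cg ch).
exact: cf.
Qed.

(** * Bilinear forms on matrix spaces *)

Section Bilinear.
Context {R : realType} {m n : nat}.
Local Notation V := 'M[R]_(m, n).
Implicit Types (F G : V) (f : V -> R) (b : V -> V -> R).

Lemma scalar_expand f F : scalar f ->
  f F = \sum_i \sum_j F i j * f (delta_mx i j).
Proof.
move=> sf; pose g : {scalar V} := HB.pack f (GRing.isLinear.Build _ _ _ _ f sf).
have -> : f F = g F by []; rewrite {1}(matrix_sum_delta F) linear_sum.
apply: eq_bigr => i _; rewrite linear_sum; apply: eq_bigr => j _.
by rewrite linearZ.
Qed.

Lemma scalar_bound f F : scalar f ->
  `|f F| <= `|F| * \sum_i \sum_j `|f (delta_mx i j)|.
Proof.
move=> sf; rewrite (scalar_expand F sf) (le_trans (ler_norm_sum _ _ _))//.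
rewrite mulr_sumr ler_sum// => i _; rewrite (le_trans (ler_norm_sum _ _ _))//.
rewrite mulr_sumr ler_sum// => j _.
by rewrite normrM ler_wpM2r// mx_norm_entry.
Qed.

Definition bilin b := (forall G, scalar (b^~ G)) /\ (forall F, scalar (b F)).

Lemma bilinDl b F G H : bilin b -> b (F + G) H = b F H + b G H.
Proof. by case=> /(_ H 1 F G); rewrite scale1r mul1r. Qed.

Lemma bilinDr b F G H : bilin b -> b H (F + G) = b H F + b H G.
Proof. by case=> _ /(_ H 1 F G); rewrite scale1r mul1r. Qed.

Lemma bilin0l b H : bilin b -> b 0 H = 0.
Proof. by case=> /(_ H (-1) 0 0); rewrite scaler0 addr0 mulN1r addNr. Qed.

Lemma bilin0r b H : bilin b -> b H 0 = 0.
Proof. by case=> _ /(_ H (-1) 0 0); rewrite scaler0 addr0 mulN1r addNr. Qed.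

Lemma bilinZl b a F H : bilin b -> b (a *: F) H = a * b F H.
Proof. by move=> bb; have := bb.1 H a F 0; rewrite !addr0 bilin0l// addr0. Qed.

Lemma bilinZr b a F H : bilin b -> b H (a *: F) = a * b H F.
Proof. by move=> bb; have := bb.2 H a F 0; rewrite !addr0 bilin0r// addr0. Qed.

Lemma bilin_expand b F G : bilin b ->
  b F G = \sum_i \sum_j \sum_k \sum_l
            F i j * G k l * b (delta_mx i j) (delta_mx k l).
Proof.
move=> [bl br]; rewrite (scalar_expand F (bl G)).
apply: eq_bigr => i _; apply: eq_bigr => j _.
rewrite (scalar_expand G (br _)) mulr_sumr; apply: eq_bigr => k _.
by rewrite mulr_sumr; apply: eq_bigr => l _; rewrite mulrA.
Qed.

Definition bilin_norm b : R :=
  \sum_i \sum_j \sum_k \sum_l `|b (delta_mx i j) (delta_mx k l)|.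

Lemma bilin_norm_ge0 b : 0 <= bilin_norm b.
Proof. by do 4!apply: sumr_ge0 => ? _. Qed.

Lemma bilin_bound b F G : bilin b -> `|b F G| <= bilin_norm b * (`|F| * `|G|).
Proof.
move=> bb; rewrite mulrC (bilin_expand _ _ bb) /bilin_norm.
do 4![rewrite (le_trans (ler_norm_sum _ _ _))// mulr_sumr ler_sum// => ? _].
by rewrite !normrM ler_wpM2r// ler_pM// mx_norm_entry.
Qed.

Lemma scalar_continuous f : scalar f -> continuous f.
Proof.
move=> sf; apply: Lipschitz_continuous => u v.
have -> : f u - f v = f (u - v).
  by have := sf (-1) v u; rewrite scaleN1r mulN1r [u - v]addrC => ->; rewrite addrC.
by rewrite mulrC; exact: scalar_bound.
Qed.

Lemma bilin_continuous b : bilin b -> continuous (fun F => b F F).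
Proof.
move=> bb; under eq_fun do rewrite (bilin_expand _ _ bb).
do 4![apply: continuous_sumr => ?] => F.
apply: (@continuousM _ _ (fun F : V => F _ _ * F _ _)); last exact: cst_continuous.
by apply: (@continuousM _ _ (fun F : V => F _ _) (fun F : V => F _ _));
  exact: coord_continuous.
Qed.

End Bilinear.

Section Penalty.
Context {R : realType} {T : topologicalType}.

(** The uniform form of the penalty principle: where the nonnegative function
    [a] vanishes the penalty [q] is positive, and elsewhere [a] itself is
    bounded below, so that a small multiple of [q] cannot spoil it. *)
Lemma compact_penalty (K : set T) (a q : T -> R) : compact K ->
  (forall x, 0 <= a x) -> lower_semicontinuous (fun x => (a x)%:E) ->
  continuous q -> (forall x, K x -> a x = 0 -> 0 < q x) ->
  exists2 delta : R, 0 < delta &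
    forall x e, K x -> 0 <= e <= delta -> e * delta <= a x + e * q x.
Proof.
move=> /compact_near_coveringP Kc a0 la cq aq.
suff : \forall D \near 0^'+, K `<=` [set x | forall e, 0 <= e <= D ->
    e * D <= a x + e * q x].
  move=> H; near (0 : R)^'+ => D; exists D => // x e Kx eD.
  by have /(_ x Kx e eD) : K `<=` [set x | forall e, 0 <= e <= D ->
    e * D <= a x + e * q x] by near: D.
apply: Kc => x Kx.
have [ax|] := eqVneq (a x) 0.
  have qx := aq _ Kx ax.
  exists ([set x' | q x / 2 < q x'], [set D | D <= q x / 2]) => /=.
    split; last by apply: nbhs_right_le; exact: divr_gt0.
    by apply: (cvgr_gt _ (cq x)); rewrite ltr_pdivrMr// ltr_pMr// ltr1n.
  move=> [x' D] /= [qx' Dq] e /andP[e0 eD].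
  by rewrite ler_wpDl// ler_wpM2l// (le_trans Dq)// ltW.
move=> ax; have {}ax : 0 < a x by rewrite lt_neqAle eq_sym ax a0.
have ax2 : ((a x / 2)%:E < (a x)%:E)%E.
  by rewrite lte_fin ltr_pdivrMr// ltr_pMr// ltr1n.
have [B Bx aB] := la x _ ax2.
have q1 : 0 < `|q x| + 2 by rewrite ltr_wpDl.
exists (B `&` [set x' | q x - 1 < q x'],
  [set D | D <= 1] `&` [set D | D <= a x / 2 / (`|q x| + 2)]) => /=.
  split; apply: filterI => //.
  - by apply: (cvgr_gt _ (cq x)); rewrite ltrBlDr ltrDl.
  - exact: nbhs_right_le.
  - by apply: nbhs_right_le; rewrite !divr_gt0.
move=> [x' D] /= [[/aB + qx'] [D1 Da]] e /andP[e0 eD]; rewrite lte_fin => ax'.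
rewrite -subr_ge0 -addrA -mulrBr (le_trans _ (lerD (ltW ax') (lexx _)))//.
have : e * (`|q x| + 2) <= a x / 2 by rewrite -ler_pdivlMr// (le_trans eD).
have : 0 <= `|q x| + q x by rewrite -lerBlDr sub0r -normrN ler_norm.
nra.
Unshelve. all: by end_near. Qed.
End Penalty.

(** * Rotations and the second elementary invariant *)

(** Sylvester's identity: eliminating one block matrix in two ways. *)
Lemma det_1sub_mulmxC (R : comNzRingType) (m n : nat) (B : 'M[R]_(m, n))
  (C : 'M[R]_(n, m)) : \det (1%:M - B *m C) = \det (1%:M - C *m B).
Proof.
have E1 : block_mx 1%:M B C 1%:M =
    block_mx 1%:M 0 C 1%:M *m block_mx 1%:M B 0 (1%:M - C *m B).
  by rewrite mulmx_block !(mulmx1, mul1mx, mul0mx, mulmx0, addr0, add0r) addrC subrK.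
have E2 : block_mx 1%:M B C 1%:M =
    block_mx (1%:M - B *m C) B 0 1%:M *m block_mx 1%:M 0 C 1%:M.
  by rewrite mulmx_block !(mulmx1, mul1mx, mul0mx, mulmx0, addr0, add0r) subrK.
have := congr1 determinant E1.
rewrite E2 !det_mulmx !det_lblock !det_ublock !det1 !mul1r !mulr1.
by move=> ->.
Qed.

(** An idempotent of rank [r] factors as [B *m C] with [C *m B] the identity
    of size [r]: its trace is [r], and [1 - 2 P] has the determinant of [- 1]
    in dimension [r]. *)
Lemma idempotent_trace_det (F : fieldType) (d : nat) (P : 'M[F]_d) :
  P *m P = P ->
  \tr P = (\rank P)%:R /\ \det (1%:M - 2 *: P) = (-1) ^+ \rank P.
Proof.
move=> PP; have := col_base_full P; have := row_base_free P.
have := mulmx_base P; move: (col_base P) (row_base P) => B C BC freeC.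
move=> /row_fullP[D DB].
have CB : C *m B = 1%:M.
  apply: (row_free_inj freeC); rewrite mul1mx.
  have BCBC : B *m (C *m B *m C) = B *m C by rewrite !mulmxA BC -mulmxA BC PP.
  by rewrite -[LHS]mul1mx -[RHS]mul1mx -DB -!(mulmxA D) BCBC.
split; first by rewrite -{1}BC mxtrace_mulC CB mxtrace1.
rewrite -{1}BC scalemxAl det_1sub_mulmxC -scalemxAr CB.
rewrite -[X in X - _]scale1r -scalerBl scalemx1 det_scalar.
by rewrite (_ : 1 - 2 = -1 :> F)//; ring.
Qed.

Lemma sum_Cauchy_Schwarz (R : realFieldType) (I : finType) (a b : I -> R) :
  (\sum_i a i * b i) ^+ 2 <= (\sum_i a i ^+ 2) * (\sum_i b i ^+ 2).
Proof.
set S := \sum_i a i * b i; set B := \sum_i b i ^+ 2.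
have B0 : 0 <= B by apply: sumr_ge0 => i _; exact: sqr_ge0.
have Q x : 0 <= (\sum_i a i ^+ 2) - 2 * x * S + x ^+ 2 * B.
  rewrite (_ : _ + _ = \sum_i (a i - x * b i) ^+ 2).
    by apply: sumr_ge0 => i _; exact: sqr_ge0.
  rewrite /S /B !mulr_sumr -sumrB -big_split/=.
  by apply: eq_bigr => i _; ring.
have [B00|Bn0] := eqVneq B 0.
  suff -> : S = 0 by rewrite expr0n/= B00 mulr0.
  apply: big1 => i _; have /eqP := B00; rewrite /B psumr_eq0; last first.
    by move=> j _; exact: sqr_ge0.
  by move=> /allP/(_ i (mem_index_enum _))/=; rewrite sqrf_eq0 => /eqP->; rewrite mulr0.
have Bp : 0 < B by rewrite lt_neqAle eq_sym Bn0.
have := Q (S / B); rewrite -(pmulr_rge0 _ Bp) mulrC => H.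
rewrite -subr_ge0; apply: le_trans H _; rewrite le_eqVlt; apply/orP; left.
by apply/eqP; field; rewrite Bn0.
Qed.

Section Rotation.
Context {R : realType} {d : nat}.
Implicit Types (H Q B : 'M[R]_d).

Lemma SO_mulmxV Q : SO Q -> Q *m Q^T = 1%:M.
Proof. by move=> [/mulmx1C]. Qed.

Lemma SO_tr Q : SO Q -> SO Q^T.
Proof. by move=> SQ; split; rewrite ?trmxK ?SO_mulmxV// det_tr; case: SQ. Qed.

Lemma SO1 : SO (1%:M : 'M[R]_d).
Proof. by split; rewrite ?trmx1 ?mul1mx ?det1. Qed.

Lemma SO_mul Q Q' : SO Q -> SO Q' -> SO (Q *m Q').
Proof.
move=> [q1 d1] [q2 d2]; split; last by rewrite det_mulmx d1 d2 mulr1.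
by rewrite trmx_mul -mulmxA (mulmxA _ Q) q1 mul1mx.
Qed.

Lemma mxdot_rotation (n : nat) Q (F G : 'M[R]_(d, n)) : SO Q ->
  mxdot (Q *m F) (Q *m G) = mxdot F G.
Proof.
move=> [qQ _]; rewrite !mxdotE trmx_mul mxtrace_mulC -!mulmxA mxtrace_mulC.
by rewrite (mulmxA Q^T) qQ mul1mx.
Qed.

(** The Cauchy-Schwarz inequality for the columns of [H]. *)
Lemma mxdot_gram_le H : mxdot (H^T *m H) (H^T *m H) <= mxdot H H ^+ 2.
Proof.
have -> : mxdot H H = \sum_i \sum_k H k i ^+ 2.
  by rewrite /mxdot exchange_big; do 2!apply: eq_bigr => ? _; rewrite expr2.
rewrite expr2 mulr_suml; apply: ler_sum => i _; rewrite mulr_sumr.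
apply: ler_sum => j _; rewrite -expr2 mxE.
under eq_bigr do rewrite mxE.
exact: sum_Cauchy_Schwarz.
Qed.

(** Twice the second elementary symmetric function of the eigenvalues. *)
Definition e2 H : R := \tr H ^+ 2 - \tr (H *m H).

Lemma mxtrace_rotation_sub1 Q : SO Q ->
  mxdot (Q - 1%:M) (Q - 1%:M) = 2 * (d%:R - \tr Q).
Proof.
move=> SQ; rewrite mxdotE linearB/= trmx1 mulmxBl !mulmxBr SO_mulmxV//.
by rewrite !mulmx1 mul1mx !raddfB/= mxtrace1 mxtrace_tr; ring.
Qed.

Lemma e2_rotation_sub1 Q :
  e2 (Q - 1%:M) = (d%:R - \tr Q) ^+ 2 - (\tr (Q *m Q) - 2 * \tr Q + d%:R).
Proof.
rewrite /e2 mulmxBl !mulmxBr !mulmx1 mul1mx !raddfB/= mxtrace1.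
ring.
Qed.

Lemma mxdot_skew_part Q : SO Q ->
  mxdot (Q - Q^T) (Q - Q^T) = 2 * (d%:R - \tr (Q *m Q)).
Proof.
move=> SQ; rewrite mxdotE linearB/= trmxK mulmxBl !mulmxBr.
by rewrite SO_mulmxV// SQ.1 -trmx_mul !raddfB/= mxtrace_tr mxtrace1; ring.
Qed.

(** For [H = Q - 1] one has [H^T H = 2 - Q - Q^T], whose squared length is an
    affine function of [\tr Q] and [\tr (Q *m Q)]; bound it by
    [mxdot_gram_le]. *)
Lemma mxtrace_sqr_rotation_le Q : SO Q ->
  \tr (Q *m Q) <= 2 * (d%:R - \tr Q) ^+ 2 - 3 * d%:R + 4 * \tr Q.
Proof.
move=> SQ; have := mxdot_gram_le (Q - 1%:M).
rewrite mxtrace_rotation_sub1//.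
have -> : (Q - 1%:M)^T *m (Q - 1%:M) = 2 *: 1%:M - (Q + Q^T).
  rewrite [(_ - _)^T]linearB/= trmx1 mulmxBl !mulmxBr SQ.1 mulmx1 !mul1mx.
  by apply/matrixP => i j; rewrite !mxE; ring.
have ST : (Q + Q^T)^T = Q + Q^T by rewrite [LHS]linearD/= trmxK addrC.
rewrite mxdotE [(_ - _)^T]linearB/= [(_ *: _)^T]linearZ/= trmx1 ST.
rewrite mulmxBl !mulmxBr -!scalemxAl -!scalemxAr !(mulmx1, mul1mx).
rewrite mulmxDl !mulmxDr SO_mulmxV// SQ.1 -trmx_mul.
rewrite !(raddfB, raddfD)/= !mxtraceZ !mxtrace_tr !mxtrace1.
lra.
Qed.

(** With [t = d - \tr Q], half the squared distance of [Q] to the identity,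
    this is a quadratic lower bound near the identity. *)
Lemma e2_rotation_ge Q : SO Q ->
  2 * (d%:R - \tr Q) - (d%:R - \tr Q) ^+ 2 <= e2 (Q - 1%:M).
Proof.
by move=> SQ; rewrite e2_rotation_sub1; have := mxtrace_sqr_rotation_le SQ; lra.
Qed.

(** The value 0 forces [Q] to be symmetric, hence [1 - Q] to be twice a
    projection; the trace leaves rank 0 or 1 only, and rank 1 would be a
    reflection. *)
Lemma e2_rotation_gt0 Q : SO Q -> Q != 1%:M -> 0 < e2 (Q - 1%:M).
Proof.
move=> SQ; rewrite ltNge; apply: contra => e0.
have I1 := mxtrace_sqr_rotation_le SQ; move: e0; rewrite e2_rotation_sub1 => e0.
have I2 : 0 <= mxdot (Q - Q^T) (Q - Q^T).
  exact: le_trans (sqr_ge0 _) (sqr_norm_le_mxdot _).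
have := I2; rewrite mxdot_skew_part// => I3.
have qd : \tr (Q *m Q) = d%:R by lra.
have t2 : (d%:R - \tr Q) * (2 - (d%:R - \tr Q)) = 0 by nra.
have eq_norm (F : 'M[R]_d) : mxdot F F = 0 -> F = 0.
  move=> F0; apply/eqP; rewrite -normr_eq0 -sqrf_eq0 eq_le sqr_ge0 andbT -F0.
  exact: sqr_norm_le_mxdot.
have Qsym : Q^T = Q.
  apply/esym/eqP; rewrite -subr_eq0; apply/eqP/eq_norm.
  by rewrite mxdot_skew_part// qd subrr mulr0.
have QQ : Q *m Q = 1%:M by rewrite -{1}Qsym SQ.1.
move/eqP: t2; rewrite mulf_eq0 => /orP[/eqP t0|/eqP t2].
  by rewrite -subr_eq0; apply/eqP/eq_norm; rewrite mxtrace_rotation_sub1// t0 mulr0.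
set P := 2^-1 *: (1%:M - Q).
have PP : P *m P = P.
  rewrite /P -scalemxAl -scalemxAr mulmxBl !mulmxBr !mulmx1 mul1mx QQ.
  by apply/matrixP => i j; rewrite !mxE; field.
have [trP detP] := idempotent_trace_det PP.
have : \rank P = 1%N.
  apply/eqP; rewrite -(eqr_nat R) -trP /P linearZ/= linearB/= mxtrace1.
  by apply/eqP; lra.
have QE : Q = 1%:M - 2 *: P by rewrite /P scalerA divff// scale1r opprB addrC subrK.
move=> rP; move: detP; rewrite -QE rP SQ.2 expr1; lra.
Qed.

End Rotation.

(** * A quadratic null Lagrangian on lattice cells *)

(** After expansion every correlation of [phi] and [psi] occurs twice, with
    opposite signs and up to a translation. *)
Lemma sum_discrete_jacobian (R : realType) (T : finZmodType) (alpha beta : T)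
    (phi psi : T -> R) :
  \sum_k ((phi (k + (alpha + beta)) - phi k) * (psi (k + beta) - psi (k + alpha))
        - (psi (k + (alpha + beta)) - psi k) * (phi (k + beta) - phi (k + alpha)))
  = 0.
Proof.
have shift (f g : T -> R) s t :
    \sum_k f (k + (s + t)) * g (k + t) = \sum_k f (k + s) * g k.
  rewrite [RHS](reindex_inj (addIr t))/=; apply: eq_bigr => k _.
  by rewrite -[k + t + s]addrA (addrC t).
have shift' (f g : T -> R) s t :
    \sum_k f (k + (s + t)) * g (k + s) = \sum_k f (k + t) * g k.
  by rewrite -[RHS](shift f g t s) (addrC t).
rewrite (eq_bigr (fun k =>
  (phi (k + (alpha + beta)) * psi (k + beta) - phi (k + alpha) * psi k)
  + (phi (k + beta) * psi k - phi (k + (alpha + beta)) * psi (k + alpha))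
  + (psi (k + (alpha + beta)) * phi (k + alpha) - psi (k + beta) * phi k)
  + (psi (k + alpha) * phi k - psi (k + (alpha + beta)) * phi (k + beta))));
  last by move=> k _; ring.
by rewrite !big_split/= !sumrN !shift !shift' !subrr !addr0.
Qed.

Section Corners.
Context {R : realType} {d : nat}.
Implicit Types (A H : 'M[R]_d) (Z F G : 'M[R]_(d, (2 ^ d)%N)).

(** Labels the columns of [Z] by the vertices of the unit cube, so that the
    two-dimensional faces of a cell become visible. *)
Definition corner_index A Z (iota : {ffun 'I_d -> bool} -> 'I_(2 ^ d)) : Prop :=
  bijective iota /\
  forall e, col (iota e) Z = A *m \col_a ((e a)%:R - 2^-1).

Lemma corner_enum_index A Z : A \in unitmx -> corner_enum A Z ->
  exists iota, corner_index A Z iota.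
Proof.
move=> uA [_ Zrange].
have ex (e : {ffun 'I_d -> bool}) :
    exists j, col j Z == A *m \col_a ((e a)%:R - 2^-1).
  have : range (fun j => col j Z) (A *m \col_a ((e a)%:R - 2^-1)).
    rewrite Zrange; exists (\col_a ((e a)%:R - 2^-1)) => // i; rewrite mxE.
    by case: (e i) => /=; [right; field | left; rewrite sub0r].
  by case=> j _ ej; exists j; rewrite ej.
have Zi e := eqP (xchooseP (ex e)).
exists (fun e => xchoose (ex e)); split => //.
apply: inj_card_bij => [e e' ee'|]; last first.
  by rewrite card_ord card_ffun card_bool card_ord.
have : A *m \col_a ((e a)%:R - 2^-1) = A *m \col_a ((e' a)%:R - 2^-1).
  by rewrite -!Zi ee'.
move/(congr1 (mulmx (invmx A))); rewrite !mulKmx// => /colP eE.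
apply/ffunP => a; have := eE a; rewrite !mxE => /addIr/eqP.
by rewrite eqr_nat; case: (e a); case: (e' a).
Qed.

Definition corner0 : {ffun 'I_d -> bool} := [ffun=> false].
Definition corner1 a : {ffun 'I_d -> bool} := [ffun c => c == a].
Definition corner2 a b : {ffun 'I_d -> bool} := [ffun c => (c == a) || (c == b)].

Lemma V0P F : V0 F <-> F *m (const_mx 1 : 'cV_(2 ^ d)) = 0.
Proof.
split=> [F0|F0 i].
  apply/colP => i; rewrite !mxE -[RHS](F0 i).
  by apply: eq_bigr => j _; rewrite mxE mulr1.
have := congr1 (fun v : 'cV_d => v i 0) F0; rewrite !mxE => Fi.
by rewrite -[RHS]Fi; apply: eq_bigr => j _; rewrite mxE mulr1.
Qed.

Lemma V0_mulmx H F : V0 F -> V0 (H *m F).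
Proof. by move=> /V0P F0; apply/V0P; rewrite -mulmxA F0 mulmx0. Qed.

Section WithIndex.
Context (A : 'M[R]_d) (Z : 'M[R]_(d, (2 ^ d)%N)).
Context (iota : {ffun 'I_d -> bool} -> 'I_(2 ^ d)).
Hypothesis uA : A \in unitmx.
Hypothesis Zi : corner_index A Z iota.

Lemma V0_corners : V0 Z.
Proof.
case: Zi => bi colZ; apply/V0P.
have -> : Z *m (const_mx 1 : 'cV_(2 ^ d)) = \sum_j col j Z.
  apply/colP => i; rewrite mxE summxE.
  by apply: eq_bigr => j _; rewrite !mxE mulr1.
rewrite (reindex iota) /=; last exact: onW_bij.
under eq_bigr do rewrite colZ.
rewrite -mulmx_sumr (_ : \sum_e _ = 0) ?mulmx0//.
pose neg (e : {ffun 'I_d -> bool}) : {ffun 'I_d -> bool} := [ffun a => ~~ e a].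
have negK : involutive neg by move=> e; apply/ffunP => a; rewrite !ffunE negbK.
apply/colP => a; rewrite summxE mxE; set S := (X in X = _).
have : S = - S.
  rewrite /S -sumrN (reindex_inj (inv_inj negK))/=.
  by apply: eq_bigr => e _; rewrite !mxE ffunE; case: (e a) => /=; field.
by move=> ?; lra.
Qed.

(** The edges of the cell at its base corner are the columns of [A], so a matrix
    can be recovered from its values at the corners. *)
Lemma corners_right_inverse : exists P : 'M[R]_((2 ^ d)%N, d), Z *m P = A.
Proof.
case: Zi => _ colZ.
exists (\matrix_(j, a) ((j == iota (corner1 a))%:R - (j == iota corner0)%:R)).
apply/matrixP => i a.
have -> : A i a = (col (iota (corner1 a)) Z - col (iota corner0) Z) i 0.
  rewrite !colZ -mulmxBr mxE (bigD1 a)//= !mxE !ffunE eqxx big1 ?addr0.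
    by rewrite /=; field.
  by move=> c ca; rewrite !mxE !ffunE (negbTE ca) subrr mulr0.
rewrite !mxE; under eq_bigr do rewrite mxE mulrBr.
rewrite sumrB; congr (_ - _).
  rewrite (bigD1 (iota (corner1 a)))//= eqxx mulr1 big1 ?addr0//.
  by move=> j /negbTE ->; rewrite mulr0.
rewrite (bigD1 (iota corner0))//= eqxx mulr1 big1 ?addr0//.
by move=> j /negbTE ->; rewrite mulr0.
Qed.

Definition diag_main a b F : 'cV[R]_d :=
  invmx A *m (col (iota (corner2 a b)) F - col (iota corner0) F).
Definition diag_cross a b F : 'cV[R]_d :=
  invmx A *m (col (iota (corner1 b)) F - col (iota (corner1 a)) F).

(** The two diagonals of the square spanned by the directions [a] and [b] at the
    base corner give the signed area of the image quadrilateral in the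
    coordinate plane [(a, b)]; summing over all planes gives, for an affine
    map, the invariant [e2] of its gradient. *)
Definition null_form F G : R :=
  2^-1 * \sum_a \sum_b (diag_main a b F a 0 * diag_cross a b G b 0
                      - diag_main a b F b 0 * diag_cross a b G a 0).

Lemma diag_main_linear a b c : scalar (fun F => diag_main a b F c 0).
Proof.
move=> x F G; rewrite /diag_main.
have -> : col (iota (corner2 a b)) (x *: F + G) - col (iota corner0) (x *: F + G) =
    x *: (col (iota (corner2 a b)) F - col (iota corner0) F) +
    (col (iota (corner2 a b)) G - col (iota corner0) G).
  by apply/colP => i; rewrite !mxE; ring.
by rewrite mulmxDr -scalemxAr mxE [X in X + _]mxE.
Qed.

Lemma diag_cross_linear a b c : scalar (fun F => diag_cross a b F c 0).
Proof.
move=> x F G; rewrite /diag_cross.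
have -> : col (iota (corner1 b)) (x *: F + G) - col (iota (corner1 a)) (x *: F + G) =
    x *: (col (iota (corner1 b)) F - col (iota (corner1 a)) F) +
    (col (iota (corner1 b)) G - col (iota (corner1 a)) G).
  by apply/colP => i; rewrite !mxE; ring.
by rewrite mulmxDr -scalemxAr mxE [X in X + _]mxE.
Qed.

Lemma null_form_bilin : bilin null_form.
Proof.
split=> [G|F] x F1 F2; rewrite /null_form (mulrCA x) -mulrDr;
  congr (_ * _); rewrite mulr_sumr -big_split; apply: eq_bigr => a _;
  rewrite mulr_sumr -big_split/=;
  apply: eq_bigr => b _.
  by rewrite !(diag_main_linear _ _ _ x); ring.
by rewrite !(diag_cross_linear _ _ _ x); ring.
Qed.

Lemma null_form_mulmx H : null_form (H *m Z) (H *m Z) = e2 H.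
Proof.
case: Zi => _ colZ.
set h := invmx A *m H *m A.
have -> : e2 H = e2 h.
  have trh K : \tr (invmx A *m K *m A) = \tr K.
    by rewrite mxtrace_mulC mulmxA mulmxV// mul1mx.
  have hh : h *m h = invmx A *m (H *m H) *m A by rewrite /h -!mulmxA mulKVmx.
  by rewrite /e2 hh /h !trh.
have -> : e2 h = \sum_a \sum_b (h a a * h b b - h a b * h b a).
  rewrite /e2 expr2 /mxtrace mulr_suml -sumrB; apply: eq_bigr => a _.
  by rewrite mulr_sumr [(h *m h) a a]mxE -sumrB; apply: eq_bigr.
have mainE a b c : a != b -> diag_main a b (H *m Z) c 0 = h c a + h c b.
  move=> ab; rewrite /diag_main !colE -!mulmxA -!colE !colZ.
  rewrite -mulmxBr mulmxA -mulmxBr mulmxA -/h.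
  rewrite mxE (bigD1 a)//= (bigD1 b) 1?eq_sym//= big1 ?addr0 => [|k /andP[ka kb]].
    by rewrite !mxE !ffunE !eqxx orbT /=; field.
  by rewrite !mxE !ffunE (negbTE ka) (negbTE kb) subrr mulr0.
have crossE a b c : a != b -> diag_cross a b (H *m Z) c 0 = h c b - h c a.
  move=> ab; rewrite /diag_cross !colE -!mulmxA -!colE !colZ.
  rewrite -mulmxBr mulmxA -mulmxBr mulmxA -/h.
  rewrite mxE (bigD1 a)//= (bigD1 b) 1?eq_sym//= big1 ?addr0 => [|k /andP[ka kb]].
    by rewrite !mxE !ffunE !eqxx (negbTE ab) eq_sym (negbTE ab) /=; field.
  by rewrite !mxE !ffunE (negbTE ka) (negbTE kb) subrr mulr0.
rewrite /null_form mulr_sumr; apply: eq_bigr => a _; rewrite mulr_sumr.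
apply: eq_bigr => b _; have [->|ab] := eqVneq a b; first by rewrite !subrr mulr0.
by rewrite !mainE// !crossE//; field.
Qed.

Lemma null_form_dim1 F : (d <= 1)%N -> null_form F F = 0.
Proof.
move=> d1; rewrite /null_form big1 ?mulr0// => a _; rewrite big1// => b _.
have -> : b = a by apply/val_inj; case: a b => [a +] [b +] /=; lia.
by rewrite subrr.
Qed.

(** Fields on the discrete torus: the sum of the quadratic form over all cells
    vanishes, because correlations are invariant under translations. *)
Lemma sum_null_form (T : finZmodType) (s : 'I_d -> T) (w : T -> 'cV[R]_d)
    (G : T -> 'M[R]_(d, (2 ^ d)%N)) :
  (forall k e e', col (iota e) (G k) - col (iota e') (G k) =
     w (k + \sum_(a | e a) s a) - w (k + \sum_(a | e' a) s a)) ->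
  \sum_k null_form (G k) (G k) = 0.
Proof.
move=> Gw; rewrite /null_form -mulr_sumr exchange_big big1 ?mulr0// => a _.
rewrite exchange_big big1// => b _.
have [->|ab] := eqVneq b a; first by rewrite big1// => k _; rewrite subrr.
pose f c k := (invmx A *m w k) c 0.
have s0 : \sum_(c | corner0 c) s c = 0 by apply: big1 => c; rewrite ffunE.
have s1 c : \sum_(c' | corner1 c c') s c' = s c.
  by rewrite (eq_bigl (pred1 c)) ?big_pred1_eq// => c'; rewrite /= ffunE.
have s2 : \sum_(c | corner2 a b c) s c = s a + s b.
  rewrite (bigD1 a)/=; last by rewrite ffunE eqxx.
  rewrite (bigD1 b)/=; last by rewrite ffunE eqxx orbT.
  by rewrite big1 ?addr0// => c; rewrite ffunE; case: (c == a); case: (c == b).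
rewrite -[RHS](sum_discrete_jacobian (s a) (s b) (f a) (f b)).
apply: eq_bigr => k _; rewrite /diag_main /diag_cross !Gw s0 !s1 s2 addr0.
by rewrite /f !mulmxBr !mxE.
Qed.

Lemma V0_const_cols F : V0 F ->
  (forall e e', col (iota e) F = col (iota e') F) -> F = 0.
Proof.
move=> F0 Fcol; case: Zi => -[kappa iK kK] _.
have FE i j : F i j = F i (iota corner0).
  by have := congr1 (fun v : 'cV_d => v i 0) (Fcol (kappa j) corner0); rewrite !mxE kK.
apply/matrixP => i j; rewrite FE [RHS]mxE; have := F0 i.
under eq_bigr do rewrite FE.
rewrite sumr_const card_ord => /eqP; rewrite mulrn_eq0 expn_eq0/=.
by move/eqP.
Qed.

(** Every node is the corner [iota e] of exactly one cell, for each [e]: all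
    columns of the sum agree. *)
Lemma sum_discrete_gradient (T : finZmodType) (s : 'I_d -> T) (w : T -> 'cV[R]_d)
    (G : T -> 'M[R]_(d, (2 ^ d)%N)) : (forall k, V0 (G k)) ->
  (forall k e e', col (iota e) (G k) - col (iota e') (G k) =
     w (k + \sum_(a | e a) s a) - w (k + \sum_(a | e' a) s a)) ->
  \sum_k G k = 0.
Proof.
move=> G0 Gw; apply: V0_const_cols => [|e e'].
  by apply/V0P; rewrite mulmx_suml big1// => k _; exact/V0P.
apply/eqP; rewrite -subr_eq0.
rewrite [col (iota e) _]linear_sum [col (iota e') _]linear_sum/= -sumrB.
under eq_bigr do rewrite Gw.
rewrite sumrB -(reindex_inj (addIr _) (P := xpredT) (F := w)).
by rewrite -(reindex_inj (addIr _) (P := xpredT) (F := w)) subrr.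
Qed.

End WithIndex.
End Corners.

(** * Second-order Taylor expansion *)

Section Taylor.
Context {R : realType}.

(** The mean value theorem, twice, for the difference of [f] and the parabola
    with the same value and slope at 0. *)
Lemma Taylor2_ge (f f1 f2 : R -> R) (c : R) :
  (forall t : R, 0 <= t <= 1 -> is_derive t (1 : R) f (f1 t)) ->
  (forall t : R, 0 <= t <= 1 -> is_derive t (1 : R) f1 (f2 t)) ->
  (forall t : R, 0 <= t <= 1 -> c <= f2 t) -> f 0 + f1 0 + c / 2 <= f 1.
Proof.
move=> df df1 f2c.
pose g (t : R) : R := f t - f1 0 * t - c / 2 * t ^+ 2.
pose g1 (t : R) : R := f1 t - f1 0 - c * t.
have dg (t : R) : 0 <= t <= 1 -> is_derive t (1 : R) g (g1 t).
  move=> /df dft; rewrite /g /g1; apply: is_derive_eq => /=.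
  by rewrite /GRing.scale/=; field.
have dg1 (t : R) : 0 <= t <= 1 -> is_derive t (1 : R) g1 (f2 t - c).
  move=> /df1 dft; rewrite /g1; apply: is_derive_eq => /=.
  rewrite /GRing.scale/=; ring.
have cont (h dh : R -> R) (b : R) : b <= 1 ->
    (forall t : R, 0 <= t <= 1 -> is_derive t (1 : R) h (dh t)) ->
    {within `[0, b], continuous h}.
  move=> b1 dh'; apply: derivable_within_continuous => t.
  rewrite in_itv/= => /andP[t0 tb].
  by have [] := dh' t _; rewrite ?t0 ?(le_trans tb).
have oc (b t : R) : b <= 1 -> t \in `]0, b[%R -> 0 <= t <= 1.
  by move=> b1; rewrite in_itv/= => /andP[t0 tb]; rewrite !ltW// (lt_le_trans tb).
have [s] := MVT ltr01 (fun t ht => dg t (oc _ _ (lexx 1) ht))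
  (cont _ _ _ (lexx 1) dg).
rewrite in_itv/= => /andP[s0 s1].
have [u] := MVT s0 (fun t ht => dg1 t (oc _ _ (ltW s1) ht))
  (cont _ _ _ (ltW s1) dg1).
rewrite in_itv/= => /andP[u0 us].
have u01 : 0 <= u <= 1 by rewrite !ltW//= (lt_trans us).
have := f2c _ u01; rewrite /g /g1 !subr0 !mulr0 subrr subr0.
move=> cu Hu Hs.
have : 0 <= (f2 u - c) * s by rewrite mulr_ge0 ?subr_ge0// ltW.
by lra.
Qed.

Context {V : normedModType R}.
Implicit Types (f W : V -> R) (X F G : V).

Lemma is_derive_line f X F (t : R) : differentiable f (X + t *: F) ->
  is_derive t (1 : R) (fun s : R => f (X + s *: F)) ('D_F f (X + t *: F)).
Proof.
move=> /(@diff_derivable _ _ _ _ _ F) df.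
have E : (fun h : R => h^-1 *: (((fun s : R => f (X + s *: F)) \o shift t)
      (h *: (1 : R)) - f (X + t *: F))) =
    (fun h : R => h^-1 *: ((f \o shift (X + t *: F)) (h *: F) - f (X + t *: F))).
  apply/funext => h /=; rewrite /shift/= scalerDl [h *: _]mulr1.
  by rewrite addrCA.
split; first by rewrite /derivable E.
by rewrite /derive E.
Qed.

Lemma hessian_Taylor_ge W X F c :
  (forall t : R, 0 <= t <= 1 -> C2_at W (X + t *: F)) ->
  (forall t : R, 0 <= t <= 1 -> c <= hessian W (X + t *: F) F F) ->
  W X + 'D_F W X + c / 2 <= W (X + F).
Proof.
move=> C2 hc.
have := @Taylor2_ge (fun t : R => W (X + t *: F)) (fun t : R => 'D_F W (X + t *: F))
  (fun t : R => hessian W (X + t *: F) F F) c.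
rewrite scale0r scale1r addr0 => H; apply: H => t t01.
- by have [dW _ _] := C2 _ t01; exact: is_derive_line.
- by have [_ dDW _] := C2 _ t01; exact: is_derive_line.
- exact: hc.
Qed.

Lemma hessian_Taylor_le W X F c :
  (forall t : R, 0 <= t <= 1 -> C2_at W (X + t *: F)) ->
  (forall t : R, 0 <= t <= 1 -> hessian W (X + t *: F) F F <= c) ->
  W (X + F) <= W X + 'D_F W X + c / 2.
Proof.
move=> C2 hc.
have := @Taylor2_ge (fun t : R => - W (X + t *: F)) (fun t : R => - 'D_F W (X + t *: F))
  (fun t : R => - hessian W (X + t *: F) F F) (- c).
rewrite scale0r scale1r addr0 => H; rewrite -lerN2 !opprD -mulNr; apply: H => t t01.
- have [dW _ _] := C2 _ t01; have := is_derive_line dW; exact: is_deriveN.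
- have [_ dDW _] := C2 _ t01; have := is_derive_line (dDW F); exact: is_deriveN.
- by rewrite lerN2 hc.
Qed.

Lemma derive_scalar f X : differentiable f X -> scalar (fun F => 'D_F f X).
Proof. by move=> df a F G; rewrite !deriveE// linearP. Qed.

Lemma near_ball_norm X Y r : `|Y - X| < r -> \forall Y' \near Y, `|Y' - X| < r.
Proof.
move=> Yr; have r0 : 0 < r - `|Y - X| by rewrite subr_gt0.
near=> Y'; rewrite -(subrK Y Y') -addrA (le_lt_trans (ler_normD _ _))//.
rewrite -ltrBrDr distrC; near: Y'; apply: cvgr_dist_lt => //; exact: cvg_id.
Unshelve. all: by end_near. Qed.
End Taylor.

Section MatrixHessian.
Context {R : realType} {m n : nat}.
Local Notation V := 'M[R]_(m, n).
Implicit Types (W : V -> R) (X Y Z F G : V).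

Lemma bilinB (b b' : V -> V -> R) : bilin b -> bilin b' ->
  bilin (fun F G => b F G - b' F G).
Proof.
by move=> [bl br] [bl' br']; split=> [G|G] a F1 F2; rewrite ?bl ?bl' ?br ?br';
  ring.
Qed.

(** Linearity in the inner direction involves the first derivatives in a
    neighborhood of [X]. *)
Lemma hessian_bilin W X : (\forall Y \near X, C2_at W Y) -> bilin (hessian W X).
Proof.
move=> C2; have [_ dDW _] := nbhs_singleton C2.
split=> [G a F F'|F]; last exact: derive_scalar.
have dG F0 : derivable ('D_F0 W) X G by apply: diff_derivable.
rewrite /hessian (@near_eq_derive _ _ _ _ (a *: 'D_F W + 'D_F' W)).
  by rewrite deriveD ?deriveZ//; exact: derivableZ.
by apply: filterS C2 => Y [dW _ _]; exact: derive_scalar.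
Qed.

(** Uniformity in the direction comes from the finitely many second partial
    derivatives. *)
Lemma hessian_near W Z (r kappa : R) : 0 < r -> 0 < kappa ->
  (forall Y, `|Y - Z| < r -> C2_at W Y) ->
  \forall Y \near Z, forall F,
    `|hessian W Y F F - hessian W Z F F| <= kappa * `|F| ^+ 2.
Proof.
move=> r0 k0 C2.
have C2Z : C2_at W Z by apply: C2; rewrite subrr normr0.
pose c := kappa / (m%:R * (n%:R * (m%:R * n%:R)) + 1).
have c0 : 0 < c by rewrite divr_gt0// ltr_wpDl// !mulr_ge0.
have N1 (x : ('I_m * 'I_n) * ('I_m * 'I_n)) : \forall Y \near Z,
    `|hessian W Y (delta_mx x.1.1 x.1.2) (delta_mx x.2.1 x.2.2) -
      hessian W Z (delta_mx x.1.1 x.1.2) (delta_mx x.2.1 x.2.2)| <= c.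
  move: (delta_mx x.1.1 x.1.2) (delta_mx x.2.1 x.2.2) => D D'.
  have [_ _ /(_ D D') cW] := C2Z.
  near=> Y; rewrite distrC; near: Y.
  exact: (@cvgr_dist_le _ _ _ _ _ (fun Y => hessian W Y D D') _ cW).
pose I := (('I_m * 'I_n) * ('I_m * 'I_n))%type.
have N := @filter_forall _ I _ _ (nbhs_filter Z) N1.
have Zr : `|Z - Z| < r by rewrite subrr normr0.
near=> Y => F.
have NY : forall x : I,
    `|hessian W Y (delta_mx x.1.1 x.1.2) (delta_mx x.2.1 x.2.2) -
      hessian W Z (delta_mx x.1.1 x.1.2) (delta_mx x.2.1 x.2.2)| <= c.
  by near: Y; exact: N.
have Yr : `|Y - Z| < r by near: Y; exact: near_ball_norm Zr.
have bY : bilin (hessian W Y).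
  by apply: hessian_bilin; apply: filterS (near_ball_norm Yr) => ? /C2.
have bZ : bilin (hessian W Z).
  by apply: hessian_bilin; apply: filterS (near_ball_norm Zr) => ? /C2.
pose b F G := hessian W Y F G - hessian W Z F G.
have bb : bilin b by exact: bilinB.
apply: le_trans (bilin_bound F F bb) _; rewrite -expr2 ler_wpM2r ?sqr_ge0//.
apply: (@le_trans _ _ (m%:R * (n%:R * (m%:R * (n%:R * c))))).
  apply: sumr_le_const => i; apply: sumr_le_const => j.
  apply: sumr_le_const => k; apply: sumr_le_const => l.
  exact: (NY ((i, j), (k, l))).
have D0 : m%:R * (n%:R * (m%:R * n%:R)) + 1 != 0 :> R.
  by rewrite gt_eqF// ltr_wpDl// !mulr_ge0.
have -> : m%:R * (n%:R * (m%:R * (n%:R * c))) = kappa - c by rewrite /c; field.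
by rewrite gerBl ltW.
Unshelve. all: by end_near. Qed.

End MatrixHessian.

(** * Optimal rotations *)

Section Compactness.
Context {R : realType}.

Lemma compact_gt0_bound (T : topologicalType) (K : set T) (q : T -> R) :
  compact K -> continuous q -> (forall x, K x -> 0 < q x) ->
  exists2 delta : R, 0 < delta & forall x, K x -> delta <= q x.
Proof.
move=> cK cq qK.
have [||||delta d0 H] := @compact_penalty _ _ K (fun=> 0) q cK.
- by [].
- move=> x a a0; exists setT => //; exact: filterT.
- exact: cq.
- by move=> x Kx _; exact: qK.
exists delta => // x Kx; have := H x delta Kx; rewrite lexx ltW// => /(_ isT).
by rewrite add0r ler_pM2l.
Qed.

Lemma continuous_prodr (T : topologicalType) (I : finType) (f : I -> T -> R) :
  (forall i, continuous (f i)) -> continuous (fun x => \prod_i f i x).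
Proof.
move=> cf x; rewrite (_ : (fun x => _) = \prod_i f i); last first.
  by apply/funext => y; rewrite fct_prodE.
elim/big_ind : _ => [|g h cg ch|i _]; first exact: cst_continuous.
  exact: (continuousM cg ch).
exact: cf.
Qed.

Lemma mxdot_bilin (m n : nat) : bilin (@mxdot R m n).
Proof.
split=> [G|G] a F F'; last by rewrite mxdotDr mxdotZr.
by rewrite mxdotDl !(mxdotC _ G) mxdotZr.
Qed.

Lemma mulmxl_continuous (m n p : nat) (B : 'M[R]_(n, p)) :
  continuous (fun F : 'M[R]_(m, n) => F *m B).
Proof.
apply: (@Lipschitz_continuous _ _ _ _ (n%:R * `|B|)) => F G.
by rewrite -mulmxBl (le_trans (mulmx_norm _ _))// -!mulrA (mulrC `|B|).
Qed.

Lemma det_continuous (d : nat) : continuous (fun Q : 'M[R]_d => \det Q).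
Proof.
rewrite /determinant; apply: continuous_sumr => s Q.
apply: (@continuousM _ _ (fun=> _)); first exact: cst_continuous.
by apply: continuous_prodr => i Q'; exact: coord_continuous.
Qed.

Lemma closed_eq_fun (T : topologicalType) (f : T -> R) (c : R) :
  continuous f -> closed [set x | f x = c].
Proof.
move=> cf; have -> : [set x | f x = c] = f @^-1` [set c] by [].
by apply: preimage_closed => [x _|]; [exact: cf | exact: closed_eq].
Qed.

Lemma SO_norm_le (d : nat) (Q : 'M[R]_d) : SO Q -> `|Q| <= d%:R.
Proof.
move=> SQ; rewrite -ler_sqr ?nnegrE//; apply: le_trans (sqr_norm_le_mxdot Q) _.
rewrite mxdotE SO_mulmxV// mxtrace1 -natrX ler_nat.
by case: d {Q SQ} => // d; rewrite -{1}[d.+1]expn1 leq_pexp2l.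
Qed.

Lemma SO_compact (d : nat) : compact (@SO R d).
Proof.
apply: (@closed_bounded_compact_mx _ _ _ _ d%:R); last exact: SO_norm_le.
have -> : @SO R d = (\bigcap_(ij in [set: 'I_d * 'I_d])
    [set Q | (Q^T *m Q) ij.1 ij.2 = (1%:M : 'M[R]_d) ij.1 ij.2])
    `&` [set Q | \det Q = 1].
  rewrite eqEsubset; split=> Q.
    by case=> oQ dQ; split => // -[i j] _ /=; rewrite oQ.
  by case=> oQ dQ; split => //; apply/matrixP => i j; exact: (oQ (i, j)).
apply: closedI; last exact/closed_eq_fun/det_continuous.
apply: closed_bigI => -[i j] _ /=; apply: closed_eq_fun.
under eq_fun do rewrite mxE; apply: continuous_sumr => k Q.
under eq_fun do rewrite mxE.
by apply: (@continuousM _ _ (fun Q : 'M[R]_d => Q k i) (fun Q : 'M[R]_d => Q k j));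
  exact: coord_continuous.
Qed.

End Compactness.

Section PlanarRotation.
Context {R : realType} {d : nat}.
Implicit Types (B : 'M[R]_d) (i j : 'I_d).

Definition planar_skew i j : 'M[R]_d := delta_mx i j - delta_mx j i.

Lemma planar_skew_tr i j : (planar_skew i j)^T = - planar_skew i j.
Proof. by rewrite linearB/= !trmx_delta opprB. Qed.

Lemma planar_skew_cube i j : i != j ->
  planar_skew i j *m planar_skew i j *m planar_skew i j = - planar_skew i j.
Proof.
move=> ij; have ji : j != i by rewrite eq_sym.
rewrite /planar_skew !(mulmxBl, mulmxBr) !mul_delta_mx_cond.
rewrite !(eqxx, negbTE ij, negbTE ji) !(mulr1n, mulr0n).
rewrite !(sub0r, subr0, mulmxBl, mulNmx, mul0mx) !mul_delta_mx_cond.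
rewrite !(eqxx, negbTE ij, negbTE ji) !(mulr1n, mulr0n).
by rewrite !subr0 oppr0 sub0r opprK opprB addrC.
Qed.

(** The Cayley transform of a skew matrix with [B ^ 3 = - B], that is, of the
    generator of the rotations of a coordinate plane, in closed form. *)
Lemma Cayley_SO B t : B^T = - B -> B *m B *m B = - B ->
  SO (1%:M + (2 * t / (1 + t ^+ 2)) *: (B + t *: (B *m B))).
Proof.
move=> BT B3; set s := 2 * t / _; set C := B *m B.
have t1 : 1 + t ^+ 2 != 0 by rewrite gt_eqF// ltr_pwDl// sqr_ge0.
have BC : B *m C = - B by rewrite mulmxA.
have CB : C *m B = - B by [].
have CC : C *m C = - C by rewrite /C -mulmxA BC mulmxN.
have CT : C^T = C by rewrite trmx_mul BT mulNmx mulmxN opprK.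
have BB : B *m B = C by [].
have sE : s * (1 + t ^+ 2) = 2 * t by rewrite /s divfK.
clearbody C s; set Q := 1%:M + _.
have QT : Q^T = 1%:M + s *: (t *: C - B).
  rewrite /Q linearD/= trmx1 linearZ/= linearD/= linearZ/= CT BT.
  by rewrite addrC addrC [- B + _]addrC.
have orth : Q^T *m Q = 1%:M.
  rewrite QT /Q !(mulmxDl, mulmxDr, mulmxN, mulNmx, mul1mx, mulmx1,
    =^~ scalemxAl, =^~ scalemxAr) BC CC CB BB.
  apply/matrixP => i j; rewrite !mxE.
  move: (C i j) (B i j) ((i == j)%:R) => c b e.
  have E : s * (2 * t - s * (1 + t ^+ 2)) = 0 by rewrite sE subrr mulr0.
  apply: (@etrans _ _ (e + c * (s * (2 * t - s * (1 + t ^+ 2))))); first by ring.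
  by rewrite E mulr0 addr0.
split => //.
have det1B : \det (1%:M - t *: B) != 0.
  pose a := t / (1 + t ^+ 2).
  have aE : a * (1 + t ^+ 2) = t by rewrite /a divfK.
  have : (1%:M - t *: B) *m (1%:M + a *: (B + t *: C)) = 1%:M.
    rewrite !(mulmxBl, mulmxDr, mul1mx, mulmx1, =^~ scalemxAl, =^~ scalemxAr).
    rewrite BC BB.
    apply/matrixP => i j; rewrite !mxE.
    move: (C i j) (B i j) ((i == j)%:R) => c b e.
    apply: (@etrans _ _ (e + b * (a * (1 + t ^+ 2) - t))); first by ring.
    by rewrite aE subrr mulr0 addr0.
  by move=> /(congr1 determinant); rewrite det_mulmx det1 => H;
    apply/eqP => E; move: H; rewrite E mul0r => /eqP; rewrite eq_sym oner_eq0.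
have QE : (1%:M - t *: B) *m Q = 1%:M + t *: B.
  rewrite /Q !(mulmxBl, mulmxDr, mul1mx, mulmx1, =^~ scalemxAl, =^~ scalemxAr).
  rewrite BC BB.
  apply/matrixP => i j; rewrite !mxE.
  move: (C i j) (B i j) ((i == j)%:R) => c b e.
  have E : s * (1 + t ^+ 2) - 2 * t = 0 by rewrite sE subrr.
  apply: (@etrans _ _ (e + t * b + b * (s * (1 + t ^+ 2) - 2 * t))); first by ring.
  by rewrite E mulr0 addr0.
have := congr1 determinant QE; rewrite det_mulmx.
have -> : 1%:M + t *: B = (1%:M - t *: B)^T.
  by rewrite linearB/= trmx1 linearZ/= BT scalerN opprK.
rewrite det_tr => H; apply: (mulfI det1B); by rewrite H mulr1.
Qed.

Lemma mxdot_planar_skew (Y : 'M[R]_d) i j :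
  mxdot Y (planar_skew i j) = Y i j - Y j i.
Proof.
have mxdot_delta k l : mxdot Y (delta_mx k l) = Y k l.
  rewrite /mxdot (bigD1 k)//= (bigD1 l)//= big1 => [|l' /negbTE ll'].
    rewrite big1 => [|k' /negbTE kk'].
      by rewrite mxE !eqxx mulr1 !addr0.
    by rewrite big1// => l' _; rewrite mxE kk' mulr0.
  by rewrite mxE ll' andbF mulr0.
by rewrite mxdotBr !mxdot_delta.
Qed.

End PlanarRotation.

Lemma linear_coef_eq0 (R : realFieldType) (a b : R) :
  (forall t, t * (a + t * b) <= 0) -> a = 0.
Proof.
move=> H; have [->//|a0] := eqVneq a 0.
(* A step in the direction of [a], so short that the quadratic term loses. *)
have := H (a / (`|b| + 1)).
have b1 : 0 < `|b| + 1 by rewrite ltr_wpDl.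
have -> : a / (`|b| + 1) * (a + a / (`|b| + 1) * b)
   = (a / (`|b| + 1)) ^+ 2 * (`|b| + b + 1) by field; rewrite gt_eqF.
rewrite pmulr_rle0; last by rewrite exprn_even_gt0//= mulf_neq0// invr_neq0// gt_eqF.
have : 0 <= `|b| + b by rewrite -lerBlDr sub0r -normrN ler_norm.
lra.
Qed.

Section OptimalRotation.
Context {R : realType} {d : nat} (Z : 'M[R]_(d, (2 ^ d)%N)).
Implicit Types G : 'M[R]_(d, (2 ^ d)%N).

(** For the rotation [Q] with [Q Z] nearest to [G], the first variation along
    the planar rotations says that the torque [Q^T G Z^T] is symmetric. *)
Lemma optimal_rotation G : V0 Z -> V0 G -> exists Q : 'M[R]_d, [/\ SO Q,
    orthogonal_compl (infinitesimal_rigid Z) (Q^T *m G - Z) &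
    mxdot (G - Q *m Z) (G - Q *m Z) <= mxdot (G - Z) (G - Z)].
Proof.
move=> Z0 G0; pose f (Q : 'M[R]_d) := mxdot (G - Q *m Z) (G - Q *m Z).
have cf : continuous f.
  move=> Q; apply: (@continuous_comp _ _ _ (fun Q : 'M[R]_d => G - Q *m Z)
    (fun F => mxdot F F)); last exact/bilin_continuous/mxdot_bilin.
  by apply: continuousB; [exact: cst_continuous | exact: mulmxl_continuous].
have [Q] := @compact_EVT_min _ R f (@SO R d) (ex_intro _ _ SO1) (@SO_compact R d)
  (continuous_subspaceT cf).
rewrite inE => SQ Qmin.
have {}Qmin Q' : SO Q' -> f Q <= f Q' by move=> SQ'; apply: Qmin; rewrite inE.
exists Q; split => //; last by have := Qmin _ SO1; rewrite /f mul1mx.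
set H := Q^T *m G.
have fE Q' : SO Q' -> f (Q *m Q') = mxdot G G - 2 * mxdot H (Q' *m Z) + mxdot Z Z.
  move=> SQ'; rewrite /f -mulmxA.
  have -> : G = Q *m H by rewrite /H mulmxA SO_mulmxV// mul1mx.
  rewrite -mulmxBr !(mxdot_rotation _ _ SQ).
  rewrite mxdotBl !mxdotBr (mxdot_rotation _ _ SQ').
  by rewrite (mxdotC (Q' *m Z) H); ring.
have Hmax Q' : SO Q' -> mxdot H (Q' *m Z) <= mxdot H Z.
  move=> SQ'; have := Qmin _ (SO_mul SQ SQ').
  have := fE _ SO1; rewrite mulmx1 mul1mx => ->; rewrite (fE _ SQ'); lra.
set Y := H *m Z^T.
have HY B : mxdot H (B *m Z) = mxdot Y B.
  by rewrite !mxdotE trmx_mul mulmxA.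
have Ysym i j : Y i j = Y j i.
  have [->//|ij] := eqVneq i j.
  apply/eqP; rewrite -subr_eq0 -mxdot_planar_skew; apply/eqP.
  set B := planar_skew i j; apply: (@linear_coef_eq0 _ _ (mxdot Y (B *m B))) => t.
  have := Hmax _ (Cayley_SO t (planar_skew_tr i j) (planar_skew_cube ij)).
  have t1 : 0 < 1 + t ^+ 2 by rewrite ltr_pwDl// sqr_ge0.
  rewrite mulmxDl mul1mx mxdotDr HY -/B mxdotZr mxdotDr mxdotZr gerDl => K.
  rewrite -(pmulr_rle0 _ (_ : 0 < 2 / (1 + t ^+ 2))) ?divr_gt0//.
  apply: le_trans K; rewrite le_eqVlt; apply/orP; left; apply/eqP.
  by field; rewrite gt_eqF.
have skew0 (K : 'M[R]_d) B : K^T = K -> B^T = - B -> mxdot K B = 0.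
  move=> KT BT; have : mxdot K B = - mxdot K B.
    rewrite -{1}KT -{1}[B]trmxK BT mxdotC /mxdot exchange_big.
    rewrite -sumrN; apply: eq_bigr => i _; rewrite -sumrN; apply: eq_bigr => j _.
    by rewrite !mxE; ring.
  by move=> ?; lra.
move=> _ [b _] [B BT <-].
have HZ0 : V0 (H - Z).
  apply/V0P; rewrite mulmxBl /H -mulmxA.
  by move/V0P: G0 => ->; move/V0P: Z0 => ->; rewrite mulmx0 subr0.
rewrite mxdotDr [X in X + _](_ : _ = 0) ?add0r; last first.
  rewrite /mxdot big1// => i _; under eq_bigr do rewrite [transl _ _ _ _]mxE.
  by rewrite -mulr_suml HZ0 mul0r.
rewrite mxdotBl HY skew0//; last by apply/matrixP => i j; rewrite mxE.
rewrite mxdotE trmx_mul mulmxA -mxdotE skew0// ?subrr//.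
by rewrite trmx_mul trmxK.
Qed.

End OptimalRotation.

(** * Coercivity of the cell energy modulo rotations *)

Section LinearFacts.
Context {R : realType} {m n : nat}.
Implicit Types (F G : 'M[R]_(m, n)).

Lemma V0_closed : closed (@V0 R m n).
Proof.
have -> : @V0 R m n = \bigcap_(i in [set: 'I_m]) [set F | \sum_j F i j = 0].
  by rewrite eqEsubset; split=> [F F0 i _|F F0 i]; [exact: F0 | exact: (F0 i)].
apply: closed_bigI => i _; apply: closed_eq_fun; apply: continuous_sumr => j F.
exact: coord_continuous.
Qed.

Lemma orthogonal_compl_closed (S : set 'M[R]_(m, n)) :
  closed (orthogonal_compl S).
Proof.
have -> : orthogonal_compl S = \bigcap_(G in S) [set F | mxdot F G = 0].
  by rewrite eqEsubset; split=> F FS G SG; exact: FS.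
apply: closed_bigI => G _; apply: closed_eq_fun; apply: scalar_continuous.
exact: (mxdot_bilin _ _).1.
Qed.

Lemma norm_sub_continuous G : continuous (fun F => `|F - G|).
Proof.
apply: (@Lipschitz_continuous _ _ _ _ 1) => F F'; rewrite mul1r.
have -> : F - F' = (F - G) - (F' - G) by rewrite opprB addrA subrK.
exact: ler_dist_dist.
Qed.

(** A form that is positive on a closed cone minus the origin is coercive
    there. *)
Lemma bilin_coercive (b : 'M[R]_(m, n) -> 'M[R]_(m, n) -> R)
    (S : set 'M[R]_(m, n)) : bilin b -> closed S ->
  (forall a F, S F -> S (a *: F)) -> (forall F, S F -> F != 0 -> 0 < b F F) ->
  exists2 c : R, 0 < c & forall F, S F -> c * `|F| ^+ 2 <= b F F.
Proof.
move=> bb clS coneS bS.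
have cK : compact (S `&` [set F | `|F - 0| = 1]).
  apply: (@closed_bounded_compact_mx _ _ _ _ 1).
    by apply: closedI => //; apply: closed_eq_fun; exact: norm_sub_continuous.
  by move=> F [_ /=]; rewrite subr0 => ->.
have [|c c0 H] := compact_gt0_bound cK (bilin_continuous bb).
  move=> F [SF /=]; rewrite subr0 => F1; apply: bS => //.
  by rewrite -normr_eq0 F1 oner_eq0.
exists c => // F SF; have [->|F0] := eqVneq F 0.
  by rewrite normr0 expr0n mulr0 bilin0l.
have nF : 0 < `|F| by rewrite normr_gt0.
have : c <= b (`|F|^-1 *: F) (`|F|^-1 *: F).
  apply: H; split; first exact: coneS.
  by rewrite /= subr0 normrZ normfV normr_id mulVf// gt_eqF.
rewrite bilinZl// bilinZr// mulrA -invfM -expr2 => K.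
by rewrite -ler_pdivlMr ?exprn_gt0// mulrC.
Qed.

Lemma derive_at_min (W : 'M[R]_(m, n) -> R) Z F (r : R) : 0 < r ->
  (forall Y, `|Y - Z| < r -> differentiable W Y) -> (forall G, W Z <= W G) ->
  'D_F W Z = 0.
Proof.
move=> r0 dW Zmin.
have E : Z = Z + (0 : R) *: F by rewrite scale0r addr0.
have line t : `|t| * `|F| < r ->
    is_derive t (1 : R) (fun s : R => W (Z + s *: F)) ('D_F W (Z + t *: F)).
  by move=> tr; apply/is_derive_line/dW; rewrite addrC addKr normrZ.
have d0 : is_derive (0 : R) (1 : R) (fun s : R => W (Z + s *: F)) ('D_F W Z).
  by rewrite {2}E; apply: line; rewrite normr0 mul0r.
have F1 : 0 < `|F| + 1 by rewrite ltr_wpDl.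
pose e := r / (`|F| + 1); have e0 : 0 < e by rewrite divr_gt0.
have d1 : is_derive (0 : R) (1 : R) (fun s : R => W (Z + s *: F)) 0.
  apply: (@derive1_at_min _ _ (- e) e 0).
  - by rewrite (@le_trans _ _ 0)// ?oppr_le0 ltW.
  - move=> t; rewrite in_itv/= -ltr_norml => te.
    have [] // := line t _; rewrite (@le_lt_trans _ _ (`|t| * (`|F| + 1)))//.
      by rewrite ler_wpM2l// lerDl.
    by rewrite -ltr_pdivlMr.
  - by rewrite in_itv/= oppr_lt0 e0.
  - by move=> t _; rewrite -E; exact: Zmin.
by have [_ <-] := d0; have [_ ->] := d1.
Qed.

End LinearFacts.

Section EnergyWell.
Context {R : realType} {d : nat} (A : 'M[R]_d) (Z : 'M[R]_(d, (2 ^ d)%N)).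
Context (iota : {ffun 'I_d -> bool} -> 'I_(2 ^ d)).
Context (uA : A \in unitmx) (Zi : corner_index A Z iota).
Context (W : 'M[R]_(d, (2 ^ d)%N) -> R) (W_ge0 : forall F, 0 <= W F).
Context (W_lsc : lower_semicontinuous (fun F => (W F)%:E)).
Context (W_inv : forall F (Q : 'M[R]_d) (b : 'cV[R]_d),
  SO Q -> W (Q *m F + transl (2 ^ d)%N b) = W F).
Context (W_min : forall F, W F = 0 <-> exists (Q : 'M[R]_d) (b : 'cV[R]_d),
  SO Q /\ F = Q *m Z + transl (2 ^ d)%N b).
Context (r0 : R) (r0_gt0 : 0 < r0).
Context (W_C2 : forall Y, `|Y - Z| < r0 -> C2_at W Y).
Context (W_hess : forall F, orthogonal_compl (infinitesimal_rigid Z) F ->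
  F != 0 -> 0 < hessian W Z F F).

Local Notation V := 'M[R]_(d, (2 ^ d)%N).
Local Notation nb := (null_form A iota).

Lemma transl0 : transl (2 ^ d)%N 0 = 0 :> V.
Proof. by apply/matrixP => i j; rewrite !mxE. Qed.

Lemma W_rot F Q : SO Q -> W (Q *m F) = W F.
Proof. by move=> SQ; rewrite -[RHS](W_inv F 0 SQ) transl0 addr0. Qed.

Lemma W_well : W Z = 0.
Proof.
by apply/W_min; exists 1%:M, 0; rewrite mul1mx transl0 addr0; split => //; exact: SO1.
Qed.

Lemma DW_well F : 'D_F W Z = 0.
Proof.
apply: (derive_at_min _ r0_gt0) => [Y /W_C2[]//|G].
by rewrite W_well.
Qed.

Lemma hessian_well_bilin : bilin (hessian W Z).
Proof.
have Zr : `|Z - Z| < r0 by rewrite subrr normr0.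
apply: hessian_bilin; apply: filterS (near_ball_norm Zr) => Y; exact: W_C2.
Qed.

(** The Hessian at [Z] is coercive across the rigid motions; by continuity it
    remains so along short segments from [Z], and [W] vanishes to first order
    at [Z]. *)
Lemma coercive_transversal : exists r m : R, [/\ 0 < r, 0 < m &
  forall E, orthogonal_compl (infinitesimal_rigid Z) E -> `|E| < r ->
    m * `|E| ^+ 2 <= W (Z + E)].
Proof.
have [|||c c0 hc] := @bilin_coercive _ _ _ (hessian W Z)
    (orthogonal_compl (infinitesimal_rigid Z)) hessian_well_bilin.
- exact: orthogonal_compl_closed.
- by move=> a F SF G SG; rewrite mxdotC mxdotZr mxdotC SF// mulr0.
- exact: W_hess.
have c2 : 0 < c / 2 by rewrite divr_gt0.
have /nbhs_normP[r1 r1_gt0 Hr1] := hessian_near r0_gt0 c2 W_C2.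
exists (Num.min r0 r1), (c / 4); split; rewrite ?divr_gt0//.
  by rewrite lt_min r0_gt0.
move=> E SE; rewrite lt_min => /andP[Er0 Er1].
have tE (t : R) : 0 <= t <= 1 -> `|Z + t *: E - Z| <= `|E|.
  move=> /andP[t0 t1]; rewrite addrC addKr normrZ ger0_norm//.
  by rewrite ler_piMl.
have := @hessian_Taylor_ge _ _ W Z E (c / 2 * `|E| ^+ 2).
rewrite W_well DW_well !add0r => H; apply: le_trans (H _ _).
- by rewrite le_eqVlt; apply/orP; left; apply/eqP; field.
- by move=> t t01; apply/W_C2/(le_lt_trans (tE _ t01)).
- move=> t t01; have := Hr1 (Z + t *: E); rewrite /ball_/= distrC.
  move=> /(_ (le_lt_trans (tE _ t01) Er1) E); rewrite ler_norml => /andP[+ _].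
  have := hc _ SE; move: (hessian W Z E E) (hessian W _ E E) => h h'; lra.
Qed.

Lemma rotation_defect_bound : exists2 a : R, 0 <= a &
  forall F : 'M[R]_d, `|F| <= a * `|F *m Z|.
Proof.
have [P ZP] := corners_right_inverse Zi.
exists ((2 ^ d)%:R * `|P *m invmx A|) => // F.
have {1}-> : F = F *m Z *m (P *m invmx A).
  by rewrite -!mulmxA (mulmxA Z) ZP mulmxV// mulmx1.
by rewrite (le_trans (mulmx_norm _ _))// -!mulrA (mulrC `|_ *m Z|).
Qed.

(** With the nearest rotation [Q], write [G - Z = (Q - 1) Z + E]. Then [W G]
    bounds [|E| ^ 2] and the null form is at least
    [|Q - 1| ^ 2 / 4 - K |E| ^ 2], so that a small multiple of it controls the
    rotation without losing control of [E]. The radius [r] must not depend on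
    [e]: [global_coercive] chooses [e] after [r]. *)
Lemma near_coercive : exists r e1 : R, [/\ 0 < r, 0 < e1 &
  forall e, 0 < e <= e1 -> exists2 c : R, 0 < c & forall G, V0 G ->
    `|G - Z| < r -> c * `|G - Z| ^+ 2 <= W G + e * nb (G - Z) (G - Z)].
Proof.
have [r1 [m [r1_gt0 m_gt0 Wm]]] := coercive_transversal.
have [a a_ge0 aZ] := rotation_defect_bound.
have nbb := null_form_bilin A iota.
set C := bilin_norm nb; have C0 : 0 <= C := bilin_norm_ge0 nb.
pose a1 : R := d%:R * `|Z|; pose a2 : R := d%:R * d%:R.
pose K := 4 * (C * a1 * a2) ^+ 2 + C * a2 ^+ 2.
pose N : R := (d * 2 ^ d)%:R.
pose L := (d * d)%:R * (a * (N + 2)) ^+ 2.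
have a10 : 0 <= a1 by rewrite mulr_ge0.
have a20 : 0 <= a2 by rewrite mulr_ge0.
have K0 : 0 <= K by rewrite addr_ge0 ?mulr_ge0 ?sqr_ge0.
have N0 : 0 <= N by [].
have L0 : 0 <= L by rewrite mulr_ge0 ?sqr_ge0.
have N1 : 0 < N + 1 by lra.
have L1 : 0 < L + 1 by lra.
exists (Num.min (r1 / (N + 1)) (L + 1)^-1), (m / (2 * (K + 1))).
split; first by rewrite lt_min divr_gt0// invr_gt0.
  by rewrite divr_gt0// mulr_gt0//; lra.
move=> e /andP[e0 eK].
have {}eK : e * K <= m / 2.
  move: eK; rewrite ler_pdivlMr; last by lra.
  by nra.
pose mu := Num.min (m / 2) (e / 4).
have mu0 : 0 < mu by rewrite lt_min !divr_gt0.
have D0 : 0 < 2 * a1 ^+ 2 + 2 * a2 ^+ 2 + 1.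
  by have := sqr_ge0 a1; have := sqr_ge0 a2; lra.
exists (mu / (2 * a1 ^+ 2 + 2 * a2 ^+ 2 + 1)); first exact: divr_gt0.
move=> G G0; rewrite lt_min ltr_pdivlMr// => /andP[gr1 gL].
have [Q [SQ Eorth Emin]] := optimal_rotation (V0_corners Zi) G0.
set E' := Q^T *m G - Z in Eorth.
set E := G - Q *m Z in Emin; set D := (Q - 1%:M) *m Z.
(* [D] is the rigid part of the displacement, [E] the elastic part; [E'] is [E]
   rotated back. *)
have GDE : G - Z = D + E by rewrite /D /E mulmxBl mul1mx [RHS]addrC addrA subrK.
have EE' : E = Q *m E' by rewrite /E /E' mulmxBr mulmxA SO_mulmxV// mul1mx.
set g := `|G - Z| in gr1 gL *; set x := `|Q - 1%:M|; set y := `|E'|.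
have g0 : 0 <= g := normr_ge0 _.
have x0 : 0 <= x := normr_ge0 _.
have y0 : 0 <= y := normr_ge0 _.
have sqrt_le (z : R) : 0 <= z -> z ^+ 2 <= N * g ^+ 2 -> z <= (N + 1) * g.
  move=> z0 zg; rewrite -ler_sqr ?nnegrE ?mulr_ge0 ?(ltW N1)//.
  apply: le_trans zg _; rewrite exprMn ler_wpM2r ?sqr_ge0//.
  by rewrite expr2; nra.
have mE : mxdot E E <= N * g ^+ 2 by apply: le_trans Emin (mxdot_le_sqr_norm _).
have yg : y <= (N + 1) * g.
  apply: sqrt_le => //; apply: le_trans mE; rewrite EE' mxdot_rotation//.
  exact: sqr_norm_le_mxdot.
have Eg : `|E| <= (N + 1) * g.
  by apply: sqrt_le => //; apply: le_trans mE; exact: sqr_norm_le_mxdot.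
have yr1 : y < r1 by apply: le_lt_trans yg _; rewrite mulrC.
have Dx : `|D| <= a1 * x.
  apply: le_trans (mulmx_norm _ _) _; rewrite /a1 -/x.
  by rewrite le_eqVlt; apply/orP; left; apply/eqP; ring.
have Ey : `|E| <= a2 * y.
  rewrite EE' (le_trans (mulmx_norm _ _))// ler_wpM2r// ler_wpM2l//.
  exact: SO_norm_le.
clearbody a1 a2.
have xg : x <= a * (N + 2) * g.
  apply: le_trans (aZ _) _; rewrite -/D -mulrA ler_wpM2l//.
  have -> : D = (G - Z) - E by rewrite GDE addrK.
  by apply: le_trans (ler_normB _ _) _; rewrite -/g; lra.
set tau := d%:R - \tr Q.
have tauE : mxdot (Q - 1%:M) (Q - 1%:M) = 2 * tau by rewrite mxtrace_rotation_sub1.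
have tau_ge : x ^+ 2 <= 2 * tau by rewrite -tauE; exact: sqr_norm_le_mxdot.
have tau_le1 : tau <= 1.
  have : 2 * tau <= L * g ^+ 2.
    rewrite -tauE (le_trans (mxdot_le_sqr_norm _))// -/x /L -mulrA -exprMn.
    by rewrite ler_wpM2l// ler_sqr ?nnegrE ?mulr_ge0//; lra.
  have : g * (L + 1) < 1 by rewrite -ltr_pdivlMr// mul1r.
  have : g <= 1 by rewrite ltW// (lt_le_trans gL)// invf_le1//; lra.
  by nra.
have e2_ge : 2^-1 * x ^+ 2 <= e2 (Q - 1%:M).
  by apply: le_trans (e2_rotation_ge SQ); rewrite -/tau; nra.
have WG : m * y ^+ 2 <= W G.
  have <- : W (Z + E') = W G.
    by rewrite -[RHS](W_rot _ (SO_tr SQ)) /E' addrC subrK.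
  exact: Wm.
(* Young's inequality absorbs the mixed terms into a quarter of [x ^+ 2]. *)
have nbG : 4^-1 * x ^+ 2 - K * y ^+ 2 <= nb (G - Z) (G - Z).
  rewrite GDE (bilinDl D E _ nbb) !(bilinDr D E _ nbb).
  rewrite (null_form_mulmx uA Zi).
  have := bilin_bound D E nbb; rewrite ler_norml => /andP[+ _].
  have := bilin_bound E D nbb; rewrite ler_norml => /andP[+ _].
  have := bilin_bound E E nbb; rewrite ler_norml => /andP[+ _].
  rewrite -/C (mulrC `|E| `|D|) => HEE HED HDE.
  have BDE : C * (`|D| * `|E|) <= C * a1 * a2 * x * y.
    rewrite -!mulrA ler_wpM2l//.
    by apply: le_trans (ler_pM _ _ Dx Ey) _ => //; rewrite mulrACA -mulrA.
  have BEE : C * (`|E| * `|E|) <= C * a2 ^+ 2 * y ^+ 2.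
    rewrite -[leRHS]mulrA ler_wpM2l// -exprMn -expr2 ler_sqr ?nnegrE// mulr_ge0//.
  have : 0 <= (2^-1 * x - 2 * (C * a1 * a2) * y) ^+ 2 by exact: sqr_ge0.
  rewrite /K; move: (C * a1 * a2) BDE => q BDE; move: (C * a2 ^+ 2) BEE => q2 BEE.
  move: (e2 _) e2_ge (nb _ _) (nb _ _) (nb _ _) HDE HED HEE => e2Q e2_ge b1 b2 b3.
  move: (C * _) (C * _) BDE BEE => c1 c2 BDE BEE HDE HED HEE sq.
  lra.
have gxy : g ^+ 2 <= (2 * a1 ^+ 2 + 2 * a2 ^+ 2 + 1) * (x ^+ 2 + y ^+ 2).
  have : g <= a1 * x + a2 * y.
    by rewrite /g GDE (le_trans (ler_normD _ _))// lerD.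
  have : 0 <= (a1 * x - a2 * y) ^+ 2 by exact: sqr_ge0.
  have := sqr_ge0 (a1 * y); have := sqr_ge0 (a2 * x).
  have := sqr_ge0 x; have := sqr_ge0 y.
  move=> h1 h2 h3 h4 h5 gle.
  have : g ^+ 2 <= (a1 * x + a2 * y) ^+ 2.
    by rewrite ler_sqr ?nnegrE// addr_ge0// mulr_ge0.
  by nra.
apply: (@le_trans _ _ (mu * (x ^+ 2 + y ^+ 2))).
  by rewrite -mulrA ler_pM2l// mulrC ler_pdivrMr// mulrC.
have mu1 : mu <= m / 2 by rewrite ge_min lexx.
have mu2 : mu <= e / 4 by rewrite ge_min lexx orbT.
have := sqr_ge0 x; have := sqr_ge0 y.
move: (x ^+ 2) (y ^+ 2) nbG WG => x2 y2 nbG WG y20 x20.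
have : e * (4^-1 * x2 - K * y2) <= e * nb (G - Z) (G - Z) by rewrite ler_pM2l.
nra.
Qed.

Context (p : R) (hp : 1 < p) (hpd : d%:R <= p).
Context (c c' : R) (c_gt0 : 0 < c) (c'_gt0 : 0 < c').
Context (W_growth : forall F, V0 F -> c * frob F `^ p - c' <= W F).

Lemma norm_le_frob (F : V) : `|F| <= frob F.
Proof.
by rewrite -[leLHS]ger0_norm// -sqrtr_sqr ler_wsqrtr// sqr_norm_le_mxdot.
Qed.

Lemma W_lower_powR (G : V) : V0 G -> 2 * `|Z| <= `|G - Z| ->
  c * (`|G - Z| / 2) `^ p - c' <= W G.
Proof.
move=> G0 gZ; apply: le_trans (W_growth G0); rewrite lerD2r ler_pM2l//.
apply: ge0_ler_powR; rewrite ?nnegrE ?sqrtr_ge0 ?divr_ge0//.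
  by rewrite ltW// (lt_trans _ hp).
apply: le_trans (norm_le_frob G).
by have := ler_normB G Z; lra.
Qed.

Lemma powR_superlinear (L : R) : 0 < L -> exists2 t0 : R, 0 <= t0 &
  forall t, t0 <= t -> L * t <= t `^ p.
Proof.
move=> L0; have p1 : 0 < p - 1 by rewrite subr_gt0.
exists (L `^ (p - 1)^-1); first exact: powR_ge0.
move=> t tL; have t0 : 0 <= t by apply: le_trans tL; exact: powR_ge0.
rewrite -{1}(subrK 1 p).
rewrite powRD ?powRr1//; last by rewrite subrK gt_eqF ?(lt_trans _ hp).
rewrite ler_wpM2r//.
have -> : L = (L `^ (p - 1)^-1) `^ (p - 1).
  by rewrite -powRrM mulVf ?gt_eqF// powRr1// ltW.
by apply: ge0_ler_powR => //; rewrite ?nnegrE ?powR_ge0// ltW.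
Qed.

(** The growth exponent beats the quadratic form: for [d >= 2] because
    [p >= d], and in dimension one the form vanishes. *)
Lemma far_coercive : exists rho e2 : R, [/\ 0 < rho, 0 < e2 &
  forall G e, V0 G -> rho <= `|G - Z| -> 0 <= e <= e2 ->
    `|G - Z| <= W G + e * nb (G - Z) (G - Z)].
Proof.
have c0 := c_gt0; have c'0 := c'_gt0.
have L0 : 0 < 8 / c by rewrite divr_gt0.
have [t0 t0_ge0 Ht0] := powR_superlinear L0.
have nbb := null_form_bilin A iota.
have C0 := bilin_norm_ge0 nb.
have c'c : 0 < 8 * c' / c by rewrite divr_gt0// mulr_gt0.
pose z := `|Z|; have z0 : 0 <= z := normr_ge0 _.
exists (2 * z + 2 * t0 + 2 + c' + 8 * c' / c), (c / (16 * (bilin_norm nb + 1))).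
split; first by lra.
  by rewrite divr_gt0// mulr_gt0//; lra.
move=> G e G0; set g := `|G - Z| => rg /andP[e0 eC].
have g0 : 0 <= g := normr_ge0 _.
have WG : c * (g / 2) `^ p - c' <= W G.
  by apply: W_lower_powR => //; rewrite -/g -/z; lra.
have W1 : 3 * g <= W G.
  apply: le_trans WG; have /Ht0 : t0 <= g / 2 by lra.
  rewrite -(ler_pM2l c_gt0) (_ : c * (8 / c * (g / 2)) = 4 * g); first by lra.
  by field; rewrite gt_eqF.
suff : 0 <= 2^-1 * W G + e * nb (G - Z) (G - Z) by lra.
have [d1|d2] := leqP d 1.
  have -> : nb (G - Z) (G - Z) = 0 by exact: null_form_dim1.
  by rewrite mulr0 addr0 mulr_ge0.
have W2 : c * (g / 2) ^+ 2 - c' <= W G.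
  apply: le_trans WG; rewrite lerD2r ler_pM2l// -powR_mulrn ?divr_ge0//.
  apply: ler_powR; first lra.
  by apply: le_trans hpd; rewrite ler_nat.
have := bilin_bound (G - Z) (G - Z) nbb; rewrite -/g ler_norml => /andP[+ _].
move: (nb _ _) (bilin_norm nb) C0 eC => b C C0 eC bC.
have eC' : e * C <= c / 16.
  move: eC; rewrite ler_pdivlMr; last by lra.
  by nra.
have : - (e * (C * (g * g))) <= e * b by rewrite -mulrN ler_wpM2l.
have : e * C * (g * g) <= c / 16 * (g * g) by rewrite ler_wpM2r// mulr_ge0.
have : 8 * c' <= c * (g * g).
  rewrite -ler_pdivrMl//; have : 8 * c' / c <= g by lra.
  by rewrite mulrC; nra.
by nra.
Qed.

Lemma well_V0 (G : V) : V0 G -> W G = 0 -> exists2 Q : 'M[R]_d, SO Q & G = Q *m Z.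
Proof.
move=> G0 /W_min[Q [b [SQ GE]]]; exists Q => //.
suff b0 : b = 0 by rewrite GE b0 transl0 addr0.
apply/colP => i; rewrite mxE.
have := G0 i; rewrite GE; under eq_bigr do rewrite mxE [transl _ _ _ _]mxE.
rewrite big_split/= sumr_const card_ord (V0_mulmx Q (V0_corners Zi) i) add0r.
by move/eqP; rewrite mulrn_eq0 expn_eq0/= => /eqP.
Qed.

(** Between the neighborhood of [Z] and infinity there is a compact annulus. The
    zeros of [W] there are rotations [Q Z] with [Q != 1], where the null form is
    positive, so [compact_penalty] applies. *)
Lemma global_coercive : exists e r m : R, [/\ 0 < e, 0 < r, 0 < m &
  forall G, V0 G ->
    (`|G - Z| < r -> m * `|G - Z| ^+ 2 <= W G + e * nb (G - Z) (G - Z)) /\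
    (r <= `|G - Z| -> m * `|G - Z| <= W G + e * nb (G - Z) (G - Z))].
Proof.
have [r [e1 [r_gt0 e1_gt0 near_c]]] := near_coercive.
have [rho [e2 [rho_gt0 e2_gt0 far_c]]] := far_coercive.
pose K := @V0 R d (2 ^ d)%N `&` [set G | r <= `|G - Z|] `&` [set G | `|G - Z| <= rho].
have cK : compact K.
  apply: (@closed_bounded_compact_mx _ _ _ _ (rho + `|Z|)).
    apply: closedI; first apply: closedI; first exact: V0_closed.
      have := @preimage_closed _ _ (fun G : V => `|G - Z|) [set x | r <= x].
      by apply; [move=> G _; exact: norm_sub_continuous | exact: closed_ge].
    have := @preimage_closed _ _ (fun G : V => `|G - Z|) [set x | x <= rho].
    by apply; [move=> G _; exact: norm_sub_continuous | exact: closed_le].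
  move=> G [_ /= Grho]; rewrite -(subrK Z G) (le_trans (ler_normD _ _))//.
  by rewrite lerD2r.
have [||delta delta_gt0 Hdelta] := compact_penalty cK W_ge0 W_lsc
    (q := fun G : V => nb (G - Z) (G - Z)).
- move=> G; apply: (@continuous_comp _ _ _ (fun G : V => G - Z) (fun F => nb F F));
    last exact/bilin_continuous/null_form_bilin.
  by apply: continuousB; [exact: cvg_id | exact: cst_continuous].
- move=> G [[G0 /= rG] _] WG0; have [Q SQ GE] := well_V0 G0 WG0.
  have -> : G - Z = (Q - 1%:M) *m Z by rewrite mulmxBl mul1mx GE.
  rewrite (null_form_mulmx uA Zi); apply: e2_rotation_gt0 => //.
  apply: contraTneq rG => Q1; rewrite GE Q1 mul1mx subrr normr0 -ltNge.
  exact: r_gt0.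
pose e := Num.min e1 (Num.min e2 delta).
have e_gt0 : 0 < e by rewrite !lt_min e1_gt0 e2_gt0.
have ee1 : e <= e1 by rewrite ge_min lexx.
have ee2 : e <= e2 by rewrite !ge_min lexx orbT.
have ed : e <= delta by rewrite !ge_min lexx !orbT.
have [|m m_gt0 Hm] := near_c e; first by rewrite e_gt0.
pose k := Num.min m (Num.min 1 (e * delta / rho)).
have k_gt0 : 0 < k by rewrite !lt_min m_gt0 ltr01 divr_gt0// mulr_gt0.
have km : k <= m by rewrite ge_min lexx.
have k1 : k <= 1 by rewrite !ge_min lexx orbT.
have kd : k <= e * delta / rho by rewrite !ge_min lexx !orbT.
exists e, r, k; split => // G G0; split=> [Gr|rG].
  by apply: le_trans (Hm _ G0 Gr); rewrite ler_wpM2r// sqr_ge0.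
have [Grho|/ltW rhoG] := leP `|G - Z| rho.
  apply: le_trans (Hdelta G e _ _); last 2 first.
  - by split.
  - by rewrite ltW.
  rewrite (@le_trans _ _ (k * rho)) ?ler_pM2l//.
  by rewrite -ler_pdivlMr.
apply: le_trans (far_c _ e G0 rhoG _); last by rewrite ltW.
by rewrite ler_piMl.
Qed.

End EnergyWell.

(** * Supporting hyperplanes near the well *)

Section Support.
Context {R : realType} {m n : nat}.
Local Notation V := 'M[R]_(m, n).
Implicit Types (X Y Z F G : V) (W : V -> R) (b : V -> V -> R).

Lemma small_gradient W Z (r theta : R) : 0 < r -> 0 < theta ->
  (forall Y, `|Y - Z| < r -> C2_at W Y) -> (forall G, W Z <= W G) ->
  \forall X \near Z, W X <= W Z + theta /\
    forall G, `|'D_G W X| <= theta * `|G|.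
Proof.
move=> r0 t0 C2 Zmin.
have Zr : `|Z - Z| < r by rewrite subrr normr0.
have [dWZ dDWZ _] := C2 _ Zr.
pose c := theta / (m%:R * n%:R + 1).
have D1 : 0 < m%:R * n%:R + 1 :> R by rewrite ltr_wpDl// mulr_ge0.
have c0 : 0 < c by rewrite divr_gt0.
have DZ G : 'D_G W Z = 0.
  by apply: (derive_at_min _ r0) => // Y /C2[].
have N1 (x : 'I_m * 'I_n) : \forall X \near Z, `|'D_(delta_mx x.1 x.2) W X| <= c.
  move: (delta_mx x.1 x.2) => D.
  have cD := differentiable_continuous (dDWZ D).
  near=> X; rewrite -[X in `|X|]subr0 -(DZ D) distrC; near: X.
  exact: (@cvgr_dist_le _ _ _ _ _ ('D_D W) _ cD).
pose I := ('I_m * 'I_n)%type.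
have N := @filter_forall _ I _ _ (nbhs_filter Z) N1.
have cW := differentiable_continuous dWZ.
near=> X.
have NX : forall x : I, `|'D_(delta_mx x.1 x.2) W X| <= c by near: X; exact: N.
have XZ : `|X - Z| < r by near: X; exact: near_ball_norm Zr.
have [dWX _ _] := C2 _ XZ.
split; last first.
  move=> G; apply: le_trans (scalar_bound G (derive_scalar dWX)) _.
  rewrite mulrC ler_wpM2r// (@le_trans _ _ (m%:R * (n%:R * c)))//.
    apply: sumr_le_const => i; apply: sumr_le_const => j; exact: (NX (i, j)).
  have -> : m%:R * (n%:R * c) = theta - c by rewrite /c; field; rewrite gt_eqF.
  by rewrite gerBl ltW.
rewrite -lerBlDl (le_trans (ler_norm _))// distrC; near: X.
exact: (@cvgr_dist_le _ _ _ _ _ W _ cW).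
Unshelve. all: by end_near. Qed.

(** On the subspace [S], [F |-> W (Z + F) + e * b F F] has a nondegenerate
    minimum at 0 and at least linear growth. Adding the form to [W] around a
    point [X] close to [Z] therefore keeps the graph above its tangent
    hyperplane at [X]: near [Z] by local convexity, far from [Z] because the
    hyperplane is almost horizontal. *)
Lemma supporting_form W Z b (S : set V) (r0 r k e : R) :
  0 < r0 -> 0 < r -> 0 < k -> 0 < e -> bilin b ->
  (forall a F G, S F -> S G -> S (a *: F + G)) ->
  (forall Y, `|Y - Z| < r0 -> C2_at W Y) -> (forall G, 0 <= W G) -> W Z = 0 ->
  (forall F, S F ->
    (`|F| < r -> k * `|F| ^+ 2 <= W (Z + F) + e * b F F) /\
    (r <= `|F| -> k * `|F| <= W (Z + F) + e * b F F)) ->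
  exists2 delta : R, 0 < delta & forall X, S (X - Z) -> `|X - Z| < delta ->
    forall G, S G -> W X + 'D_G W X <= W (X + G) + e * b G G.
Proof.
move=> r0_gt0 r_gt0 k_gt0 e_gt0 bb linS C2 W0 WZ coer.
have SZ a F : S F -> S (a *: F).
  move=> SF; have := linS (a - 1) F F SF SF.
  by rewrite scalerBl scale1r subrK.
have Wmin G : W Z <= W G by rewrite WZ.
have DZ G : 'D_G W Z = 0 by apply: (derive_at_min _ r0_gt0) => // Y /C2[].
have k2 : 0 < k / 2 by rewrite divr_gt0.
have /nbhs_normP[r1 /= r1_gt0 Hr1] := hessian_near r0_gt0 k2 C2.
have {}Hr1 Y : `|Y - Z| < r1 -> forall F,
    `|hessian W Y F F - hessian W Z F F| <= k / 2 * `|F| ^+ 2.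
  by move=> YZ; apply: Hr1; rewrite /ball_/= distrC.
pose r2 := Num.min r0 (Num.min r1 r).
have r2_gt0 : 0 < r2 by rewrite !lt_min r0_gt0 r1_gt0.
have r20 : r2 <= r0 by rewrite ge_min lexx.
have r21 : r2 <= r1 by rewrite !ge_min lexx orbT.
have r2r : r2 <= r by rewrite !ge_min lexx !orbT.
clearbody r2.
have Zr0 : `|Z - Z| < r0 by rewrite subrr normr0.
have bH : bilin (hessian W Z).
  by apply: hessian_bilin; apply: filterS (near_ball_norm Zr0) => Y; exact: C2.
(* Comparing the lower bound with the Taylor expansion along short vectors shows
   that the Hessian of [W + e b] at [Z] is positive definite on [S]. *)
have hess_small F : S F -> `|F| < r2 ->
    3 / 2 * k * `|F| ^+ 2 <= hessian W Z F F + 2 * (e * b F F).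
  move=> SF Fr.
  have tF (t : R) : 0 <= t <= 1 -> `|Z + t *: F - Z| < r2.
    move=> /andP[t0 t1]; rewrite addrC addKr normrZ ger0_norm//.
    by apply: le_lt_trans Fr; rewrite ler_piMl.
  have := @hessian_Taylor_le _ _ W Z F (hessian W Z F F + k / 2 * `|F| ^+ 2).
  rewrite WZ DZ !add0r => /(_ _ _)/wrap[].
    by move=> t t01; apply: C2; apply: lt_le_trans (tF _ t01) r20.
  move=> t t01; have := Hr1 _ (lt_le_trans (tF _ t01) r21) F.
  by rewrite ler_norml => /andP[_]; rewrite lerBlDl.
  have [+ _] := coer _ SF => /(_ (lt_le_trans Fr r2r)).
  move: (hessian W Z F F) (W (Z + F)) (b F F) (`|F| ^+ 2) => h w bF F2; lra.
have hess_ge F : S F ->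
    3 / 2 * k * `|F| ^+ 2 <= hessian W Z F F + 2 * (e * b F F).
  move=> SF; have F1 : 0 < `|F| + 1 by rewrite ltr_wpDl.
  pose a := r2 / (`|F| + 1); have a0 : 0 < a by rewrite divr_gt0.
  have := hess_small _ (SZ a _ SF); rewrite normrZ gtr0_norm//.
  have -> : a * `|F| < r2.
    by rewrite /a mulrAC ltr_pdivrMr// ltr_pM2l// ltrDl.
  move=> /(_ isT); rewrite !bilinZl// !bilinZr//.
  have a2 : 0 < a ^+ 2 by rewrite exprn_gt0.
  move=> H; rewrite -(ler_pM2l a2); move: H; clearbody a.
  move: (hessian W Z F F) (b F F) (`|F|) => h bF f; lra.
(* Both end points in a ball where the Hessian of [W + e b] is nonnegative. *)
have local X G : `|X - Z| < r2 -> `|X + G - Z| < r2 -> S G ->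
    W X + 'D_G W X <= W (X + G) + e * b G G.
  move=> Xr XGr SG.
  have tG (t : R) : 0 <= t <= 1 -> `|X + t *: G - Z| < r2.
    move=> /andP[t0 t1].
    have -> : X + t *: G - Z = (1 - t) *: (X - Z) + t *: (X + G - Z).
      by apply/matrixP => i j; rewrite !mxE; ring.
    apply: le_lt_trans (ler_normD _ _) _; rewrite !normrZ !ger0_norm ?subr_ge0//.
    have [t0'|t1'] := leP t 2^-1; first nra.
    nra.
  have := @hessian_Taylor_ge _ _ W X G (- (2 * (e * b G G))).
  move=> /(_ _ _)/wrap[].
    by move=> t t01; apply: C2; apply: lt_le_trans (tG _ t01) r20.
  move=> t t01; have := Hr1 _ (lt_le_trans (tG _ t01) r21) G.
  rewrite ler_norml => /andP[+ _].
  have := hess_ge _ SG; have : 0 <= `|G| ^+ 2 by exact: sqr_ge0.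
  move: (hessian W Z G G) (hessian W _ G G) (b G G) (`|G| ^+ 2) => h h' bG G2; nra.
  move: ('D_G W X) (b G G) => D bG; lra.
pose k' := Num.min k (k * r2).
have k'_gt0 : 0 < k' by rewrite lt_min k_gt0 mulr_gt0.
have far F : S F -> r2 <= `|F| -> k' * `|F| <= W (Z + F) + e * b F F.
  move=> SF rF; have [small large] := coer _ SF.
  have [Fr|rF'] := ltP `|F| r.
    apply: le_trans (small Fr); rewrite expr2 mulrA ler_wpM2r//.
    by apply: (@le_trans _ _ (k * r2)); rewrite ?ge_min ?lexx ?orbT// ler_pM2l.
  by apply: le_trans (large rF'); rewrite ler_wpM2r// ge_min lexx.
(* Far from [Z] the growth [k' * |Y|] has to absorb [theta * (1 + |G|)] from the
   tangent plane and the terms of [b] mixing [Y] and [eta]; [D] collects their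
   coefficients relative to [theta * |Y|], using [r2 <= |Y|]. *)
pose C := bilin_norm b; have C0 : 0 <= C := bilin_norm_ge0 b.
pose D := 2 / r2 + 1 + 2 * e * C + e * C / r2.
have D_gt0 : 0 < D.
  have : 0 < 2 / r2 by rewrite divr_gt0.
  have : 0 <= 2 * e * C by rewrite !mulr_ge0// ltW.
  have : 0 <= e * C / r2 by rewrite divr_ge0 ?mulr_ge0// ltW.
  by rewrite /D; lra.
pose theta := k' / D; have theta_gt0 : 0 < theta by rewrite divr_gt0.
have /nbhs_normP[d1 /= d1_gt0 Hd1] := small_gradient r0_gt0 theta_gt0 C2 Wmin.
exists (Num.min (Num.min d1 r2) (Num.min theta 1)).
  by rewrite !lt_min d1_gt0 r2_gt0 theta_gt0 ltr01.
move=> X SX; rewrite !lt_min => /andP[/andP[Xd1 Xr2] /andP[Xt X1]] G SG.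
have [XGr|rXG] := ltP `|X + G - Z| r2; first exact: local.
have [|WX DX] := Hd1 X; first by rewrite /ball_/= distrC.
set eta := X - Z in Xt X1 SX *; set Y := X + G - Z in rXG.
have YE : Y = eta + G by rewrite /Y /eta addrAC.
have SY : S Y by rewrite YE -[eta]scale1r; apply: linS.
have := far _ SY rXG; rewrite [Z + Y]addrC subrK => fY.
have GE : G = Y - eta by rewrite YE addrC addKr.
have Gle : `|G| <= `|Y| + `|eta| by rewrite GE ler_normB.
clearbody eta Y.
have := DX G; rewrite ler_norml => /andP[_ DG].
move: WX; rewrite WZ add0r => WX.
have bG : b Y Y - 2 * C * (`|Y| * `|eta|) - C * (`|eta| * `|eta|) <= b G G.
  have -> : b G G = b Y Y - b Y eta - b eta Y + b eta eta.
    rewrite {1 2}GE -scaleN1r (bilinDl _ _ _ bb) !(bilinDr _ _ _ bb).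
    by rewrite !(bilinZl _ _ _ bb) !(bilinZr _ _ _ bb); ring.
  have := bilin_bound Y eta bb; rewrite ler_norml => /andP[_ +].
  have := bilin_bound eta Y bb; rewrite ler_norml => /andP[_ +].
  have := bilin_bound eta eta bb; rewrite ler_norml => /andP[+ _].
  rewrite -/C (mulrC `|eta| `|Y|) -(mulrA 2 C).
  move: (b Y Y) (b Y eta) (b eta Y) (b eta eta) (C * _) (C * _) => *; lra.
have thetaE : theta * D = k' by rewrite /theta divfK// gt_eqF.
have h0 : 0 <= `|eta| := normr_ge0 _.
have y0 : 0 <= `|Y| := normr_ge0 _.
move: (W X) ('D_G W X) (W (X + G)) (b Y Y) (b G G) (`|G|) (`|Y|) (`|eta|)
  WX DG fY bG Gle h0 y0 rXG Xt X1 => w dw wG bY bGG g y h.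
move=> WX DG fY bG Gle h0 y0 ry ht h1.
have {}bG : e * bY - 2 * (e * C) * (y * h) - e * C * (h * h) <= e * bGG.
  by move: bG; rewrite -(ler_pM2l e_gt0); lra.
have eC : 0 <= e * C by rewrite mulr_ge0// ltW.
have B1 : theta * g <= theta * y + theta * h by rewrite -mulrDr ler_pM2l.
have B2 : e * C * (y * h) <= e * C * theta * y.
  by rewrite -[leRHS]mulrA ler_wpM2l// mulrC ler_wpM2r// ltW.
have B3 : e * C * (h * h) <= e * C * theta.
  rewrite ler_wpM2l//; apply: (@le_trans _ _ (theta * h)).
    by rewrite ler_wpM2r// ltW.
  by rewrite ler_piMr// ltW.
have B4 : theta * h <= theta by rewrite ler_piMr// ltW.
have yr : 1 <= y / r2 by rewrite ler_pdivlMr// mul1r.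
have B5 : theta <= theta * (y / r2) by rewrite ler_peMr// ltW.
have B6 : e * C * theta <= e * C * theta * (y / r2).
  by rewrite ler_peMr// mulr_ge0// ltW.
have : k' * y = 2 * (theta * (y / r2)) + theta * y + 2 * (e * C * theta * y)
    + e * C * theta * (y / r2).
  by rewrite -thetaE /D; field; rewrite gt_eqF.
lra.
Qed.

End Support.

(** * Cells, nodes and the discrete torus *)

Section Cells.
Context {R : realType} {d : nat} (A : 'M[R]_d) (uA : A \in unitmx).
Implicit Types (z : 'cV[int]_d) (x : 'cV[R]_d) (N : nat).

Definition lattice_point z : 'cV[R]_d := A *m map_mx intr z.
Definition half_diag : 'cV[R]_d := A *m const_mx 2^-1.

Lemma coords_lattice_point z i : (invmx A *m lattice_point z) i 0 = (z i 0)%:~R.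
Proof. by rewrite /lattice_point mulKmx// mxE. Qed.

Lemma coords_shift z (t : 'cV[R]_d) i :
  (invmx A *m (lattice_point z + A *m t)) i 0 = (z i 0)%:~R + t i 0.
Proof.
by rewrite mulmxDr [in LHS]mxE coords_lattice_point mulKmx.
Qed.

Lemma cell_corner_lattice_point z (t : 'cV[R]_d) : (forall i, 0 <= t i 0 < 1) ->
  cell_corner A (lattice_point z + A *m t) = lattice_point z.
Proof.
by move=> t01; apply/esym/cell_cornerP => //; split; [exists z | exists t].
Qed.

Lemma half01 : 0 <= (2^-1 : R) < 1.
Proof. by rewrite invr_ge0 ler0n/= invf_lt1 ?ltr1n. Qed.

Lemma cell_corner_center z :
  cell_corner A (lattice_point z + half_diag) = lattice_point z.
Proof. by apply: cell_corner_lattice_point => i; rewrite mxE half01. Qed.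

Lemma cell_corner_node z : cell_corner A (lattice_point z) = lattice_point z.
Proof.
rewrite -{1}[lattice_point z]addr0 -[X in _ + X](mulmx0 _ A).
by apply: cell_corner_lattice_point => i; rewrite mxE lexx ltr01.
Qed.

Lemma center_node z : Defs.center A (lattice_point z) = lattice_point z + half_diag.
Proof. by rewrite /Defs.center cell_corner_node. Qed.

Lemma centers_center z : centers A (lattice_point z + half_diag).
Proof. by exists (lattice_point z) => //; exists z. Qed.

Lemma centersP x : centers A x -> exists z, x = lattice_point z + half_diag.
Proof. by move=> [_ [z _ <-] <-]; exists z. Qed.

Lemma cubeP N x : cube A N x <-> forall i, 0 < (invmx A *m x) i 0 < N%:R.
Proof.
split=> [[t t0N <-] i|xN]; first by rewrite mulKmx//; exact: t0N.
by exists (invmx A *m x) => //; rewrite mulKVmx.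
Qed.

Lemma coord_map_continuous i : continuous (fun x => (invmx A *m x) i 0).
Proof.
apply: (@Lipschitz_continuous _ _ _ _ (d%:R * `|invmx A|)) => u v.
have -> : (invmx A *m u) i 0 - (invmx A *m v) i 0 = (invmx A *m (u - v)) i 0.
  by rewrite mulmxBr !mxE.
exact: le_trans (mx_norm_entry _ _ _) (mulmx_norm _ _).
Qed.

(** The closed cell is not computed exactly: an upper bound for inclusions and
    its two extreme corners for exclusions are enough. *)
Lemma closure_cell_sub z x : closure (cell A (lattice_point z)) x ->
  forall i, (z i 0)%:~R <= (invmx A *m x) i 0 <= (z i 0)%:~R + 1.
Proof.
move=> + i.
have cl (P : set R) : closed P ->
    (forall t, 0 <= t < 1 -> P ((z i 0)%:~R + t)) ->
    closure (cell A (lattice_point z)) `<=` (fun x => (invmx A *m x) i 0) @^-1` P.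
  move=> clP HP; have clP' : closed ((fun x => (invmx A *m x) i 0) @^-1` P).
    by apply: preimage_closed => // y _; exact: coord_map_continuous.
  rewrite [X in _ `<=` X](iffLR (closure_id _) clP').
  apply: closure_subset => _ [t t01 <-] /=.
  by rewrite coords_shift; exact: HP.
move=> zx; apply/andP; split.
  apply: (cl _ (@closed_ge _ (z i 0)%:~R) _ _ zx) => t /andP[t0 _] /=.
  by rewrite lerDl.
apply: (cl _ (@closed_le _ ((z i 0)%:~R + 1)) _ _ zx) => t /andP[_ t1] /=.
by rewrite lerD2l ltW.
Qed.

Lemma closure_cell_top z :
  closure (cell A (lattice_point z)) (lattice_point z + A *m const_mx 1).
Proof.
move=> B Bz.
have cf : continuous (fun s : R => lattice_point z + A *m const_mx s).
  apply: (@Lipschitz_continuous _ _ _ _ (d%:R * `|A|)) => s t.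
  rewrite opprD addrACA subrr add0r -mulmxBr (le_trans (mulmx_norm _ _))//.
  by rewrite ler_wpM2l ?mulr_ge0//; apply: mx_norm_le => // i j; rewrite !mxE.
have Bs : \forall s \near (1 : R), B (lattice_point z + A *m const_mx s).
  exact: cf 1 B Bz.
have Bl : \forall s \near (1 : R)^'-, B (lattice_point z + A *m const_mx s).
  by apply: cvg_within; exact: Bs.
near (1 : R)^'- => s.
exists (lattice_point z + A *m const_mx s); split; last by near: s.
exists (const_mx s) => // i; rewrite mxE; apply/andP; split.
  by near: s; apply: nbhs_left_ge; exact: ltr01.
by near: s; exact: nbhs_left_lt.
Unshelve. all: by end_near. Qed.

Lemma int_centersP N z : int_centers A (cube A N) (lattice_point z + half_diag) <->
  forall i, (1 <= z i 0)%R && (z i 0 + 2 <= N%:Z)%R.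
Proof.
rewrite /int_centers /= /Q1 cell_corner_center; split=> [[_ sub] i|zN].
  have low : cell A (lattice_point z) (lattice_point z).
    by exists 0; rewrite ?mulmx0 ?addr0// => j; rewrite mxE lexx ltr01.
  have /cubeP/(_ i)/andP[+ _] := sub _ (subset_closure low).
  rewrite coords_lattice_point ltr0z => z0.
  have /cubeP/(_ i)/andP[_] := sub _ (@closure_cell_top z).
  rewrite coords_shift mxE.
  rewrite -[1]/(1%:~R) -intrD -[N%:R]/(N%:Z%:~R) ltr_int => zN.
  by apply/andP; split; lia.
split; first exact: centers_center.
move=> x zx; apply/cubeP => i.
have /andP[z1 z2] := zN i; have /andP[x1 x2] := closure_cell_sub zx i.
apply/andP; split.
  by apply: lt_le_trans x1; rewrite ltr0z; lia.
apply: le_lt_trans x2 _.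
by rewrite -[1]/(1%:~R) -intrD -[N%:R]/(N%:Z%:~R) ltr_int; lia.
Qed.

Lemma centers_in_center N z : (forall i, (0 <= z i 0 < N%:Z)%R) ->
  centers_in A (cube A N) (lattice_point z + half_diag).
Proof.
move=> zN; split; first exact: centers_center.
exists (lattice_point z + half_diag); split.
  rewrite /Q1 cell_corner_center; apply: subset_closure.
  by exists (const_mx 2^-1) => // i; rewrite mxE half01.
apply/cubeP => i; rewrite coords_shift mxE.
have /andP[z0 z1] := zN i; have /andP[h0 h1] := half01.
have : (0 : R) <= (z i 0)%:~R by rewrite ler0z.
have : (z i 0)%:~R + 1 <= N%:R :> R.
  by rewrite -[1]/(1%:~R) -intrD -[N%:R]/(N%:Z%:~R) ler_int; lia.
move: ((z i 0)%:~R : R) => zr zN1 zr0; apply/andP; split; lra.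
Qed.

Context (Z : 'M[R]_(d, (2 ^ d)%N)) (iota : {ffun 'I_d -> bool} -> 'I_(2 ^ d)).
Context (Zi : corner_index A Z iota).

Definition corner_step (e : {ffun 'I_d -> bool}) : 'cV[int]_d :=
  \col_a (e a : nat)%:Z.

Lemma center_corner z e :
  lattice_point z + half_diag + col (iota e) Z = lattice_point (z + corner_step e).
Proof.
rewrite Zi.2 /half_diag /lattice_point -!mulmxDr; congr (_ *m _).
apply/colP => a; rewrite !mxE intrD; case: (e a) => /=; rewrite ?intr1 -?addrA;
  by congr (_ + _); field.
Qed.

(** The outermost cells meeting the cube have base corners with a coordinate 0
    or [N - 1]. Their corners inside the cube are the lattice points with a
    coordinate 1 or [N - 1]: on the lower faces the corner differs from the base
    corner. *)
Lemma bd_lattice_node N z : (forall i, (1 <= z i 0 < N%:Z)%R) ->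
  (exists i, z i 0 = 1 \/ z i 0 = N%:Z - 1) ->
  bd_lattice A Z (cube A N) (lattice_point z).
Proof.
move=> zN [i zi].
have [e [z' [zE z'0 z'i]]] : exists e z', [/\ z = z' + corner_step e,
    forall a, (0 <= z' a 0 < N%:Z)%R & z' i 0 = 0 \/ z' i 0 = N%:Z - 1].
  case: zi => zi; [exists (corner1 i) | exists corner0];
    [exists (z - corner_step (corner1 i)) | exists z]; split.
  - by rewrite subrK.
  - move=> a; rewrite !mxE ffunE; have := zN a; case: eqP => [->|_] /=; lia.
  - by left; rewrite !mxE ffunE eqxx zi.
  - by apply/colP => a; rewrite !mxE ffunE addr0.
  - by move=> a; have := zN a; lia.
  - by right.
exists (lattice_point z' + half_diag).
  split; first exact: centers_in_center.
  by move=> /int_centersP/(_ i); case: z'i => ->; lia.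
by exists (iota e) => //; rewrite center_corner zE.
Qed.

Lemma B1_bd_node N g y z : B1_bd A Z (cube A N) g y ->
  (forall i, (1 <= z i 0 < N%:Z)%R) ->
  (exists i, z i 0 = 1 \/ z i 0 = N%:Z - 1) ->
  y (lattice_point z) = g (lattice_point z + half_diag).
Proof.
move=> [_ ybd] zN zb; rewrite -center_node; apply: ybd.
  exact: bd_lattice_node.
split; first by rewrite /Q1 cell_corner_node; exists 0;
  rewrite ?mulmx0 ?addr0// => j; rewrite mxE lexx ltr01.
apply/cubeP => i; rewrite coords_lattice_point -[N%:R]/(N%:Z%:~R) ltr_int ltr0z.
by have := zN i; lia.
Qed.


Lemma B1_bd_interp U g : B1_bd A Z U g (fun x => g (Defs.center A x)).
Proof.
have corner_cell x u : Q1 A x u -> Defs.center A u = Defs.center A x.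
  move=> xu; rewrite /Defs.center; congr (_ + _); apply/esym/cell_cornerP => //.
  split=> //; exists (\col_i Num.floor ((invmx A *m x) i 0)) => //.
  by rewrite /cell_corner; congr (_ *m _); apply/colP => i; rewrite !mxE.
split=> [x _ u v [xu _] [xv _]|x _ u [xu _]]; last by rewrite (corner_cell x).
by rewrite (corner_cell x u)// (corner_cell x v).
Qed.

End Cells.

Section Torus.
Context {R : realType} {d : nat} (A : 'M[R]_d) (uA : A \in unitmx).
Context (Z : 'M[R]_(d, (2 ^ d)%N)) (iota : {ffun 'I_d -> bool} -> 'I_(2 ^ d)).
Context (Zi : corner_index A Z iota) (m : nat).
Implicit Types (k : 'rV['I_m.+1]_d) (z : 'cV[int]_d).
Local Notation T := 'rV['I_m.+1]_d.
Local Notation node z := (lattice_point A z).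
Local Notation half := (half_diag A).

(** The cells inside [cube A m.+3] have base corners with coordinates from 1 to
    [m + 1], one period of the torus; the nodes with a coordinate [m + 2] are
    identified with those with this coordinate 1. *)
Definition torus_node k : 'cV[int]_d := \col_a (k 0 a).+1%:Z.

Lemma torus_nodeE k a : torus_node k a 0 = (k ord0 a).+1%:Z.
Proof. by rewrite mxE. Qed.

Definition torus_step (a : 'I_d) : T := \row_b (if b == a then inZp 1 else 0).

Lemma torus_shiftE k (e : {ffun 'I_d -> bool}) b :
  nat_of_ord ((k + \sum_(a | e a) torus_step a) 0 b) = ((k ord0 b + e b) %% m.+1)%N.
Proof.
rewrite mxE summxE.
have -> : \sum_(a | e a) torus_step a 0 b = inZp (e b) :> 'I_m.+1.
  case: (boolP (e b)) => eb.
    rewrite (bigD1 b)//= mxE eqxx big1 ?addr0// => a /andP[_ ab].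
    by rewrite mxE eq_sym (negbTE ab).
  rewrite big1 => [|a ea]; first exact/val_inj.
  by rewrite mxE; case: eqP => // ba; rewrite ba ea in eb.
by rewrite /= modnDmr.
Qed.

Definition zero_on_boundary_nodes (w : 'cV[int]_d -> 'cV[R]_d) : Prop := forall z,
  (forall i, (1 <= z i 0 < m.+3%:Z)%R) ->
  (exists i, z i 0 = 1 \/ z i 0 = m.+3%:Z - 1) -> w z = 0.

(** A field that vanishes on the boundary nodes does not see the cut of the
    torus: the nodes identified there are all boundary nodes. *)
Lemma zero_boundary_torus w k (e : {ffun 'I_d -> bool}) : zero_on_boundary_nodes w ->
  w (torus_node k + corner_step e) =
  w (torus_node (k + \sum_(a | e a) torus_step a)).
Proof.
move=> w0.
have [small|[a big]] : (forall a, (k ord0 a + e a < m.+1)%N) \/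
    exists a, (m.+1 <= k ord0 a + e a)%N.
  have [/forallP|/forallPn[a]] := boolP [forall a, (k ord0 a + e a < m.+1)%N].
    by left.
  by rewrite -leqNgt; right; exists a.
  congr w; apply/colP => a; rewrite [LHS]mxE !torus_nodeE [corner_step e a 0]mxE.
  rewrite torus_shiftE modn_small//.
have ka := ltn_ord (k ord0 a).
have ea : e a = true by move: big; case: (e a) => //=; lia.
have kam : (k ord0 a : nat) = m by move: big; rewrite ea /=; lia.
rewrite !w0//.
- by move=> i; rewrite torus_nodeE; case: (_ ord0 i) => v /= vm; lia.
- by exists a; left; rewrite torus_nodeE torus_shiftE ea kam addn1 modnn.
- move=> i; rewrite mxE torus_nodeE [corner_step e i 0]mxE.
  by case: (k ord0 i) => v /= vm; case: (e i) => /=; lia.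
- exists a; right; rewrite mxE torus_nodeE [corner_step e a 0]mxE ea kam /=; lia.
Qed.

Lemma sum_int_centers (f : 'cV[R]_d -> R) :
  \sum_(x \in int_centers A (cube A m.+3)) f x =
  \sum_(k : T) f (node (torus_node k) + half).
Proof.
rewrite (@reindex_fsbig _ _ _ _ _ (fun k : T => node (torus_node k) + half) [set: T]).
  rewrite (_ : [set: T] = [set` xpredT]); last by apply/seteqP; split.
  rewrite -(@bigfs _ _ _ _ (index_enum T))//; first exact: index_enum_uniq.
  by move=> k _; rewrite mem_index_enum.
split=> [k _|k k' _ _|x intx].
- apply/(int_centersP uA) => i; rewrite torus_nodeE.
  by case: (k ord0 i) => v /= vm; lia.
- move=> /addIr/(congr1 (mulmx (invmx A))) E; apply/rowP => i.
  have := congr1 (fun v : 'cV_d => v i 0) E; rewrite !coords_lattice_point// !mxE.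
  by move/eqP; rewrite eqr_int => /eqP[]; exact: val_inj.
- have [z xz] := centersP intx.1; move: intx; rewrite xz => /(int_centersP uA) zN.
  have bnd i : (`|z i 0%R|.-1 < m.+1)%N by have := zN i; lia.
  exists (\row_i Ordinal (bnd i)) => //; congr (node _ + _).
  by apply/colP => i; rewrite !mxE/=; have := zN i; lia.
Qed.

Lemma dgradE y x i j : dgrad Z y x i j =
  y (x + col j Z) i 0 - (2 ^ d)%:R^-1 * \sum_l y (x + col l Z) i 0.
Proof. by rewrite !mxE summxE. Qed.

Lemma dgrad_V0 y x : V0 (dgrad Z y x).
Proof.
move=> i; under eq_bigr do rewrite dgradE.
rewrite sumrB sumr_const card_ord -[X in _ - X]mulr_natl mulrA mulfV ?mul1r ?subrr//.
Qed.

Lemma dgrad_sub_V0 y x (M : 'M[R]_d) : V0 (dgrad Z y x - M *m Z).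
Proof.
apply/V0P; rewrite mulmxBl; move/V0P: (dgrad_V0 y x) => ->.
by move/V0P: (V0_mulmx M (V0_corners Zi)) => ->; rewrite subr0.
Qed.

Lemma dgrad_sub_colB y x (M : 'M[R]_d) j j' :
  col j (dgrad Z y x - M *m Z) - col j' (dgrad Z y x - M *m Z) =
  (y (x + col j Z) - M *m (x + col j Z + half)) -
  (y (x + col j' Z) - M *m (x + col j' Z + half)).
Proof.
have subACA (a b c e : 'cV[R]_d) : a - b - (c - e) = a - c - (b - e).
  by rewrite !opprB addrACA [RHS]addrACA; congr (_ + _); rewrite addrC.
rewrite [col j _]linearB [col j' _]linearB/= subACA [RHS]subACA; congr (_ - _).
  by apply/colP => i; rewrite !mxE; ring.
rewrite !colE -!mulmxA -!colE -!mulmxBr; congr (_ *m _).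
by rewrite opprD addrACA subrr addr0 opprD addrACA subrr add0r.
Qed.

Lemma dgrad_interp M k :
  dgrad Z (fun x => M *m Defs.center A x) (node (torus_node k) + half) = M *m Z.
Proof.
apply/eqP; rewrite -subr_eq0; apply/eqP; apply: (V0_const_cols Zi) => [|e e'].
  exact: dgrad_sub_V0.
apply/eqP; rewrite -subr_eq0 dgrad_sub_colB !(center_corner Zi) !center_node//.
by rewrite !subrr.
Qed.

(** Jensen's inequality with a null Lagrangian: the terms of the supporting
    function that are linear or of the form [null_form] sum up to zero over the
    cells of a field with zero boundary values. *)
Lemma min_energy_affine W (M Q : 'M[R]_d) L (c : R) :
  scalar L ->
  (forall G, V0 G -> W (M *m Z) + L (Q *m G) <=
     W (M *m Z + G) + c * null_form A iota (Q *m G) (Q *m G)) ->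
  min_energy A Z W M m.+3 = (m.+1%:R) ^+ d * W (M *m Z).
Proof.
move=> sL support.
have cardT : \sum_(k : T) W (M *m Z) = m.+1%:R ^+ d * W (M *m Z).
  by rewrite sumr_const card_mx card_ord mul1n -natrX mulr_natl.
have lower y : B1_bd A Z (cube A m.+3) (mulmx M) y ->
    m.+1%:R ^+ d * W (M *m Z) <=
    \sum_(x \in int_centers A (cube A m.+3)) W (dgrad Z y x).
  move=> yB; rewrite sum_int_centers.
  pose w z := Q *m (y (node z) - M *m (node z + half)).
  have wbd : zero_on_boundary_nodes w.
    by move=> z zN zb; rewrite /w (B1_bd_node uA Zi yB zN zb) subrr mulmx0.
  pose G k := dgrad Z y (node (torus_node k) + half) - M *m Z.
  have G0 k : V0 (G k) by exact: dgrad_sub_V0.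
  have Gw k e e' : col (iota e) (Q *m G k) - col (iota e') (Q *m G k) =
      w (torus_node (k + \sum_(a | e a) torus_step a)) -
      w (torus_node (k + \sum_(a | e' a) torus_step a)).
    rewrite -!zero_boundary_torus// /w -mulmxBr !colE -!mulmxA -!colE.
    rewrite -mulmxBr; congr (_ *m _).
    by rewrite /G dgrad_sub_colB !(center_corner Zi).
  have nullG : \sum_(k : T) null_form A iota (Q *m G k) (Q *m G k) = 0.
    exact: (sum_null_form A (w := fun k => w (torus_node k)) Gw).
  have linG : \sum_(k : T) Q *m G k = 0.
    exact: (sum_discrete_gradient Zi (w := fun k => w (torus_node k))
      (fun k => V0_mulmx Q (G0 k)) Gw).
  have sumL : \sum_(k : T) L (Q *m G k) = 0.
    have L0 : L 0 = 0 by have := sL (-1) 0 0; rewrite scaler0 addr0 mulN1r addNr.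
    have LD F F' : L (F + F') = L F + L F'.
      by have := sL 1 F F'; rewrite scale1r mul1r.
    by rewrite -(big_morph L LD L0) linG L0.
  rewrite -cardT -[leLHS]addr0 -[X in _ + X <= _]sumL -big_split/=.
  rewrite -[leRHS]addr0 -[X in _ <= _ + X](mulr0 c) -[X in c * X]nullG.
  rewrite mulr_sumr -big_split/=; apply: ler_sum => k _.
  by have := support _ (G0 k); rewrite [M *m Z + G k]addrC subrK.
apply/eqP; rewrite eq_le; apply/andP; split; last first.
  apply: lb_le_inf => [|_ [y yB <-]]; last exact: lower.
  exists (\sum_(x \in int_centers A (cube A m.+3))
    W (dgrad Z (fun x => M *m Defs.center A x) x)).
  by exists (fun x => M *m Defs.center A x) => //; exact: B1_bd_interp.
apply: ge_inf.
  by exists (m.+1%:R ^+ d * W (M *m Z)) => _ [y yB <-]; exact: lower.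
exists (fun x => M *m Defs.center A x); first exact: B1_bd_interp.
by rewrite sum_int_centers -cardT; apply: eq_bigr => k _; rewrite dgrad_interp.
Qed.

End Torus.

Lemma scaled_limit (R : realType) (d : nat) (u : R ^nat) (c : R) :
  (forall m, u m.+3 = m.+1%:R ^+ d * c) ->
  (fun N => (N%:R ^+ d)^-1 * u N) @ \oo --> c.
Proof.
move=> uE; rewrite -(cvg_shiftn 3).
have -> : [sequence ((n + 3)%N%:R ^+ d)^-1 * u (n + 3)%N]_n =
    (fun n => (1 - 2 * (n + 3)%N%:R^-1) ^+ d * c).
  apply/funext => n /=; rewrite addn3 uE mulrA -exprVn -exprMn; congr (_ ^+ _ * _).
  have n3 : (n.+3%:R : R) != 0 by rewrite pnatr_eq0.
  apply: (mulfI n3); rewrite mulrA mulfV// mul1r mulrBr mulrCA mulfV// !mulr1.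
  by rewrite -!natr1; ring.
have H : (fun n => 1 - 2 * ((n + 3)%N%:R^-1 : R)) @ \oo --> (1 - 2 * 0 : R).
  apply: cvgB; first exact: cvg_cst.
  apply: cvgM; first exact: cvg_cst.
  have := @cvg_harmonic R; rewrite -(cvg_shiftn 2).
  rewrite (_ : [sequence harmonic (n + 2)%N]_n = (fun n => (n + 3)%N%:R^-1))//.
  by apply/funext => n /=; rewrite addn2 addn3.
rewrite mulr0 subr0 in H.
have := cvgM (cvg_comp _ _ H (@exprn_continuous R d 1)) (cvg_cst c).
by rewrite expr1n mul1r; exact.
Qed.

(** * The Cauchy-Born rule *)

Theorem theorem1p8 (R : realType) (d : nat) (hd : (0 < d)%N)
  (p : R) (hp : 1 < p)
  (A : 'M[R]_d) (hA : A \in unitmx)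
  (Z : 'M[R]_(d, (2 ^ d)%N)) (hZ : corner_enum A Z)
  (W : 'M[R]_(d, (2 ^ d)%N) -> R) (W_ge0 : forall F, 0 <= W F)
  (W_lsc : lower_semicontinuous (fun F => (W F)%:E))
  (W_growth : exists c c' c'' : R, [/\ 0 < c, 0 < c', 0 < c'' &
     forall F, V0 F ->
       c * frob F `^ p - c' <= W F <= c'' * (frob F `^ p + 1)])
  (W_inv : forall (F : 'M[R]_(d, (2 ^ d)%N)) (Q : 'M[R]_d) (b : 'cV[R]_d),
     SO Q -> W (Q *m F + transl (2 ^ d)%N b) = W F)
  (W_min : forall F : 'M[R]_(d, (2 ^ d)%N), W F = 0 <->
     exists (Q : 'M[R]_d) (b : 'cV[R]_d),
       SO Q /\ F = Q *m Z + transl (2 ^ d)%N b)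
  (W_C2 : exists2 O : set 'M[R]_(d, (2 ^ d)%N),
     set_nbhs [set Q *m Z | Q in @SO R d] O & forall F, O F -> C2_at W F)
  (W_hess : forall F : 'M[R]_(d, (2 ^ d)%N),
     orthogonal_compl (infinitesimal_rigid Z) F -> F != 0 ->
     0 < hessian W Z F F)
  (hpd : d%:R <= p) :
  exists2 U : set 'M[R]_d, set_nbhs (@SO R d) U &
    forall M : 'M[R]_d, U M ->
      cvgn (scaled_min_energy A Z W M) /\ W_cont A Z W M = W_CB A Z W M.
Proof.
have [iota Zi] := corner_enum_index hA hZ.
have [U0 ZU0 WU0] := W_C2.
have /nbhs_normP[r0 /= r0_gt0 Or0] : nbhs Z U0.
  by apply: ZU0; exists 1%:M; [exact: SO1 | rewrite mul1mx].
have {WU0 Or0}C2 Y : `|Y - Z| < r0 -> C2_at W Y.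
  by move=> YZ; apply/WU0/Or0; rewrite /ball_/= distrC.
have [c [c' [c'' [c_gt0 c'_gt0 _ growth]]]] := W_growth.
have growth_lower F : V0 F -> c * frob F `^ p - c' <= W F by move=> /growth/andP[].
have [e [r [k [e_gt0 r_gt0 k_gt0 coer]]]] := global_coercive hA Zi W_ge0 W_lsc
  W_inv W_min r0_gt0 C2 W_hess hp hpd c_gt0 c'_gt0 growth_lower.
have Z0 := V0_corners Zi.
have V0_linear a (F G : 'M[R]_(d, (2 ^ d)%N)) : V0 F -> V0 G -> V0 (a *: F + G).
  move=> /V0P F0 /V0P G0; apply/V0P.
  by rewrite mulmxDl -scalemxAl F0 G0 scaler0 addr0.
have [|F F0|delta delta_gt0 support] := supporting_form r0_gt0 r_gt0 k_gt0 e_gt0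
  (null_form_bilin A iota) V0_linear C2 W_ge0.
- exact: W_well W_min.
- have GF : Z + F - Z = F by rewrite addrC addKr.
  by have := coer (Z + F); rewrite GF; apply; rewrite -[Z]scale1r; exact: V0_linear.
(* By frame indifference it suffices to treat matrices near the identity. *)
pose rho := Num.min delta r0.
have rho_gt0 : 0 < rho by rewrite lt_min delta_gt0.
pose s := d%:R * `|Z| + 1.
have s_gt0 : 0 < s by rewrite ltr_wpDl// mulr_ge0.
exists [set M | exists2 Q : 'M[R]_d, SO Q & `|Q^T *m M - 1%:M| * s < rho].
  move=> Q SQ /=.
  have QQ : `|Q - Q| < rho / s / (d%:R * d%:R + 1).
    by rewrite subrr normr0 !divr_gt0// ltr_wpDl// mulr_ge0.
  apply: filterS (near_ball_norm QQ) => M MQ /=; exists Q => //.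
  rewrite -SQ.1 -mulmxBr -ltr_pdivlMr//.
  apply: le_lt_trans (mulmx_norm _ _) _.
  apply: (@le_lt_trans _ _ ((d%:R * d%:R + 1) * `|M - Q|)).
    rewrite ler_wpM2r// (@le_trans _ _ (d%:R * d%:R))// ?lerDl//.
    by rewrite ler_wpM2l// SO_norm_le//; exact: SO_tr.
  by rewrite mulrC -ltr_pdivlMr// ltr_wpDl// mulr_ge0.
move=> M [Q SQ MQ]; set M' := Q^T *m M in MQ.
have ME : M = Q *m M' by rewrite /M' mulmxA SO_mulmxV// mul1mx.
have SQT := SO_tr SQ.
have XZ : `|M' *m Z - Z| < rho.
  have -> : M' *m Z - Z = (M' - 1%:M) *m Z by rewrite mulmxBl mul1mx.
  apply: le_lt_trans (mulmx_norm _ _) _; apply: le_lt_trans MQ.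
  by rewrite -mulrA mulrCA ler_wpM2l// lerDl.
move: XZ; rewrite lt_min => /andP[XZdelta XZr0].
have [dW _ _] := C2 _ XZr0.
have rotW F : W (Q^T *m F) = W F by exact: (W_rot W_inv).
have min_energyE m : min_energy A Z W M m.+3 = m.+1%:R ^+ d * W (M *m Z).
  apply: (min_energy_affine hA Zi (Q := Q^T) (c := e) _ (derive_scalar dW)) => G G0.
  rewrite -(rotW (M *m Z)) -(rotW (M *m Z + G)) mulmxDr mulmxA -/M'.
  apply: support => //; last exact: V0_mulmx.
  rewrite -scaleN1r addrC; apply: V0_linear => //; exact: V0_mulmx.
have lim_energy : scaled_min_energy A Z W M @ \oo --> W (M *m Z).
  exact: scaled_limit min_energyE.
split; first by apply/cvg_ex; exists (W (M *m Z)).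
by rewrite /W_cont /W_CB (cvg_lim _ lim_energy).
Qed.
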